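(* For every $\lambda\in P$ and $\beta\in Q_+$, $$\sum_{\alpha\in Q_+,\ \beta-\alpha\in Q_+}J^{\alpha-\lambda-2\rho}_\alpha J^{\lambda-\alpha}_{\beta-\alpha}\,q^{-(\alpha,\alpha)/2+(\lambda+\rho,\alpha)}=\delta_{\beta,0}.$$ If moreover $\mathfrak g$ is of type $A$, $D$ or $E$, then $$\sum_{\alpha\in Q_+,\ \beta-\alpha\in Q_+}J^{\alpha-\lambda-2\rho}_\alpha J^{\lambda-\alpha}_{\beta-\alpha}=\frac{1}{(q)_\beta}.$$
   Context: Let $\mathfrak g$ be a complex simple Lie algebra of rank $l$, simple roots $\alpha_i$, fundamental weights $\omega_i$, $P=\oplus\mathbb Z\omega_i$, $Q_+=\oplus\mathbb Z_{\ge0}\alpha_i$, invariant form $(\cdot,\cdot)$ with $(P,Q)\subset\mathbb Z$, $d_i=(\alpha_i,\alpha_i)/2$ relatively prime positive integers, $\rho=\sum\omega_i$. $\mathcal N$ a positive integer with $(P,P)\subset\frac1{\mathcal N}\mathbb Z$, $\mathbb K=\mathbb C(v^{1/\mathcal N})$, $v_i=v^{d_i}$, $q=v^2$, $q_i=q^{d_i}$, $(a;p)_n=\prod_{k=0}^{n-1}(1-ap^k)$, $(q)_\beta=\prod_i(q_i;q_i)_{m_i}$ for $\beta=\sum m_i\alpha_i$. $U_v(\mathfrak g)$: generators $E_i,F_i,K_\mu$ ($\mu\in P$), relations $K_\mu K_{\mu'}=K_{\mu+\mu'}$, $K_0=1$, $K_\mu E_iK_\mu^{-1}=v^{(\mu,\alpha_i)}E_i$,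 $K_\mu F_iK_\mu^{-1}=v^{-(\mu,\alpha_i)}F_i$, $[E_i,F_j]=\delta_{ij}\frac{K_i-K_i^{-1}}{v_i-v_i^{-1}}$, quantum Serre relations. $U_{v^{-1}}(\mathfrak g)$: same with $v\to v^{-1}$, generators $\bar E_i,\bar F_i,\bar K_\mu$. $\sigma$ the anti-isomorphism $E_i\mapsto\bar F_i$, $F_i\mapsto\bar E_i$, $K_\mu\mapsto\bar K_\mu^{-1}$. Verma modules $\mathcal V^\lambda$ (generator ${\bf 1}^\lambda$, $E_i{\bf 1}^\lambda=0$, $K_\mu{\bf 1}^\lambda=v^{(\mu,\lambda)}{\bf 1}^\lambda$), $\bar{\mathcal V}^\lambda$ (generator $\bar{\bf 1}^\lambda$, $\bar E_i\bar{\bf 1}^\lambda=0$, $\bar K_\mu\bar{\bf 1}^\lambda=v^{-(\mu,\lambda)}\bar{\bf 1}^\lambda$), weight components $(\mathcal V^\lambda)_\beta$, $(\bar{\mathcal V}^\lambda)_\beta$ of weight $\lambda-\beta$; pairing with $({\bf 1}^\lambda,\bar{\bf 1}^\lambda)=1$, $(xw,w')=(w,\sigma(x)w')$. Whittaker vectors: for skew-symmetric $\epsilon$ ($\epsilon_{ij}\in\{\pm1\}$ for adjacent nodes, $0$ otherwise), $\nu_i\in P$ with $(\nu_i,\alpha_j)-(\nu_j,\alpha_i)=\epsilon_{ij}(\alpha_i,\alpha_j)$, nonzero $c_i\in\mathbb K$: $\theta^\lambda=\sum_\beta\theta^\lambda_\beta\in\prod_\beta(\mathcal V^\lambda)_\beta$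 unique with $\theta^\lambda_0={\bf 1}^\lambda$, $E_iK_{\nu_i}\theta^\lambda=\frac{c_i}{1-v_i^2}\theta^\lambda$; $\bar\theta^\lambda\in\prod_\beta(\bar{\mathcal V}^\lambda)_\beta$ unique with $\bar\theta^\lambda_0=\bar{\bf 1}^\lambda$, $\bar E_i\bar K_{\nu_i}\bar\theta^\lambda=\frac{c_i^{-1}}{1-v_i^{-2}}\bar\theta^\lambda$. $J^\lambda_\beta=v^{-(\beta,\beta)/2+(\lambda,\beta)}(\theta^\lambda_\beta,\bar\theta^\lambda_\beta)$ for $\beta\in Q_+$, independent of $\epsilon,\nu,c$.
   Formalization: Not every λ∈P is covered: it is assumed that for each α≤β the components of θ and θ̄ up to the degree needed for J^{α-λ-2ρ}_α and J^{λ-α}_{β-α} exist and are unique (for sl_2, λ=0, β=α_1 there is no θ^0, so J is undefined). *)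

(* Defs.v *)
From HB Require Import structures.
From mathcomp Require Import all_boot all_order all_algebra fraction.
From mathcomp Require Import complex reals.
From Stdlib Require Import ClassicalEpsilon.

Set Implicit Arguments.
Unset Strict Implicit.
Unset Printing Implicit Defensive.

Import Order.TTheory GRing.Theory Num.Theory.
Local Open Scope ring_scope.

(* Root datum of a complex simple Lie algebra g of rank l, given by its       *)
(* Cartan matrix A (a_ij = <alpha_i^vee, alpha_j>) and the symmetrizing       *)
(* integers d_i = (alpha_i,alpha_i)/2, so that (alpha_i,alpha_j) = d_i a_ij.   *)
(* Weights lambda in P are given in the basis of fundamental weights          *)
(* (lambda : 'I_l -> int); elements beta = sum m_i alpha_i of Q_+ are given   *)
(* by their coefficients (beta : 'I_l -> nat).                                *)

(* complex simple Lie algebra = indecomposable Cartan matrix of finite type,  *)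
(* with d_i relatively prime positive integers making d_i a_ij symmetric.    *)
Definition cartan_simple (l : nat) (A : 'M[int]_l) (d : 'I_l -> nat) : Prop :=
  (0 < l)%N /\
  (forall i, A i i = 2) /\
  (forall i j, i != j -> A i j <= 0) /\
  (forall i, (0 < d i)%N) /\
  (forall i j, (d i)%:Z * A i j = (d j)%:Z * A j i) /\
  (\big[gcdn/0%N]_i d i = 1%N) /\
  (* finite type: the invariant form on Q (x) Q is positive definite *)
  (forall x : 'I_l -> rat, (exists i, x i != 0) ->
      0 < \sum_i \sum_j x i * x j * (d i)%:R * (A i j)%:~R) /\
  (* simple (not merely semisimple): the Dynkin diagram is connected *)
  (forall S : {set 'I_l}, (exists i, i \in S) -> (exists j, j \notin S) ->
      exists i j, [/\ i \in S, j \notin S & A i j != 0]).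

(* g of type A, D or E  (= simply laced) *)
Definition typeADE (l : nat) (A : 'M[int]_l) : Prop :=
  forall i j, i != j -> (A i j == 0) || (A i j == -1).

Section QuantumData.
Variables (l : nat) (A : 'M[int]_l) (d : 'I_l -> nat).

(* the simple root alpha_j in fundamental weight coordinates is (a_kj)_k *)
Definition rootw (b : 'I_l -> nat) : 'I_l -> int :=
  fun k => \sum_j (b j)%:Z * A k j.

(* (lambda, beta) for lambda in P, beta in Q_+ : (omega_i, alpha_j) = d_j delta_ij *)
Definition formPQ (lam : 'I_l -> int) (b : 'I_l -> nat) : int :=
  \sum_j lam j * (b j)%:Z * (d j)%:Z.

Definition formQQ (b b' : 'I_l -> nat) : int :=
  \sum_i \sum_j (b i)%:Z * (b' j)%:Z * ((d i)%:Z * A i j).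

(* (lambda, mu) on P : (omega_i, omega_j) = d_i (A^-1)_ij *)
Definition formPP (lam mu : 'I_l -> int) : rat :=
  \sum_i \sum_j (lam i)%:~R * (mu j)%:~R * (d i)%:R *
     (invmx (map_mx (fun z : int => z%:~R : rat) A)) i j.

Definition fundw (i : 'I_l) : 'I_l -> int := fun k => (k == i)%:Z.

Definition N_ok (N : nat) : Prop :=
  (0 < N)%N /\ forall i j, denq (N%:R * formPP (fundw i) (fundw j)) = 1.

Definition eps_ok (eps : 'I_l -> 'I_l -> int) : Prop :=
  [/\ (forall i j, eps i j = - eps j i),
      (forall i j, i != j -> A i j != 0 -> (eps i j == 1) || (eps i j == -1)) &
      (forall i j, (i == j) || (A i j == 0) -> eps i j = 0)].

(* (nu_i, alpha_j) - (nu_j, alpha_i) = eps_ij (alpha_i, alpha_j) *)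
Definition nu_ok (eps : 'I_l -> 'I_l -> int) (nu : 'I_l -> 'I_l -> int) : Prop :=
  forall i j, nu i j * (d j)%:Z - nu j i * (d i)%:Z = eps i j * ((d i)%:Z * A i j).

Definition leQ (g b : 'I_l -> nat) : Prop := forall k, (g k <= b k)%N.
Definition addroot (g : 'I_l -> nat) (i : 'I_l) : 'I_l -> nat :=
  fun k => (g k + (k == i))%N.
Definition subQ (b g : 'I_l -> nat) : 'I_l -> nat := fun k => (b k - g k)%N.
Definition zeroQ : 'I_l -> nat := fun _ => 0%N.

Variables (K : fieldType) (N : nat).

(* tt plays the role of v^(1/N);  vq tt x = v^x  for x in (1/N) Z *)
Definition vq (tt : K) (x : rat) : K := tt ^ (numq (x * N%:R)).

Definition qint (tt : K) (i : 'I_l) (n : int) : K :=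
  (vq tt ((d i)%:R * n%:~R) - vq tt (- ((d i)%:R * n%:~R))) /
  (vq tt (d i)%:R - vq tt (- (d i)%:R)).
Definition qfact tt i (n : nat) : K := \prod_(k < n) qint tt i k.+1%:Z.
Definition qbin tt i (n r : nat) : K := qfact tt i n / (qfact tt i r * qfact tt i (n - r)).

(* Verma module V^lambda = U_v(g) 1^lambda.  A vector is represented by a     *)
(* finite formal linear combination of words; the word [:: j1; ...; jk]       *)
(* stands for F_j1 F_j2 ... F_jk 1^lambda.  Vectors are identified modulo the *)
(* span of the quantum Serre relations (two-sided ideal of U_v^-), i.e.       *)
(* V^lambda = U_v^- 1^lambda  (triangular decomposition).                    *)
Definition lc := seq (K * seq 'I_l).

Definition coef (x : lc) (w : seq 'I_l) : K := \sum_(p <- x | p.2 == w) p.1.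
Definition scale (a : K) (x : lc) : lc := [seq (a * p.1, p.2) | p <- x].

(* action of E_i on F_w 1^lambda, using  E_i F_j = F_j E_i +                  *)
(* delta_ij (K_i - K_i^-1)/(v_i - v_i^-1)  and  E_i 1^lambda = 0,             *)
(* K_mu 1^lambda = v^(mu,lambda) 1^lambda                                      *)
Fixpoint Eword (tt : K) (i : 'I_l) (lam : 'I_l -> int) (w : seq 'I_l) : lc :=
  match w with
  | [::] => [::]
  | j :: w' =>
      [seq (p.1, j :: p.2) | p <- Eword tt i lam w'] ++
      (if j == i
       then [:: (qint tt i (lam i - rootw (fun k => count_mem k w') i), w')]
       else [::])
  end.

Definition Elc (tt : K) (i : 'I_l) (lam : 'I_l -> int) (x : lc) : lc :=
  flatten [seq scale p.1 (Eword tt i lam p.2) | p <- x].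

Definition serre (tt : K) (i j : 'I_l) : lc :=
  let n := `|1 - A i j|%N in
  [seq ((-1) ^+ r * qbin tt i n r, nseq (n - r) i ++ j :: nseq r i)
  | r <- iota 0 n.+1].

Definition serre_elt (tt : K) (s : K * seq 'I_l * 'I_l * 'I_l * seq 'I_l) : lc :=
  let '(a, u, i, j, w) := s in
  scale a [seq (p.1, u ++ p.2 ++ w) | p <- serre tt i j].

Definition veq (tt : K) (x y : lc) : Prop :=
  exists s : seq (K * seq 'I_l * 'I_l * 'I_l * seq 'I_l),
    all (fun p => let '(_, _, i, j, _) := p in i != j) s /\
    forall w, coef x w - coef y w = coef (flatten [seq serre_elt tt p | p <- s]) w.

(* x lies in the weight component (V^lambda)_g, of weight lambda - g *)
Definition isWt (x : lc) (g : 'I_l -> nat) : bool :=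
  all (fun p => [forall k, count_mem k p.2 == g k]) x.

(* Whittaker vector theta = (theta_g)_g, with components up to weight b:      *)
(* theta_0 = 1^lambda,  E_i K_{nu_i} theta = c_i/(1 - v_i^2) theta            *)
Definition WhitTr (tt : K) (c : 'I_l -> K) (nu : 'I_l -> 'I_l -> int)
    (lam : 'I_l -> int) (b : 'I_l -> nat) (th : ('I_l -> nat) -> lc) : Prop :=
  [/\ veq tt (th zeroQ) [:: (1, [::])],
      (forall g, leQ g b -> isWt (th g) g) &
      (forall i g, leQ (addroot g i) b ->
        veq tt
          (scale (vq tt (formPP (nu i) (fun k => lam k - rootw (addroot g i) k)))
                 (Elc tt i lam (th (addroot g i))))
          (scale (c i / (1 - vq tt (2 * (d i)%:R))) (th g)))].

Definition WhitOK tt c nu lam b : Prop :=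
  (exists th, WhitTr tt c nu lam b th) /\
  (forall th th', WhitTr tt c nu lam b th -> WhitTr tt c nu lam b th' ->
     forall g, leQ g b -> veq tt (th g) (th' g)).

(* pairing V^lambda x Vbar^lambda -> K, (1,1bar) = 1, (F_j w, w') = (w, Ebar_j w'); *)
(* Vbar^lambda is the same construction for U_{v^-1}, i.e. with tt^-1         *)
Fixpoint pairw (tt : K) (lam : 'I_l -> int) (w : seq 'I_l) (y : lc) : K :=
  match w with
  | [::] => coef y [::]
  | j :: w' => pairw tt lam w' (Elc tt^-1 j lam y)
  end.
Definition pairing (tt : K) lam (x y : lc) : K :=
  \sum_(p <- x) p.1 * pairw tt lam p.2 y.

Definition Wdef tt c nu lam b : Prop :=
  WhitOK tt c nu lam b /\ WhitOK tt^-1 (fun i => (c i)^-1) nu lam b.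

Definition Jval (tt : K) c nu (lam : 'I_l -> int) (b : 'I_l -> nat) : K :=
  let th := epsilon (inhabits (fun _ => [::])) (WhitTr tt c nu lam b) in
  let thb := epsilon (inhabits (fun _ => [::]))
                     (WhitTr tt^-1 (fun i => (c i)^-1) nu lam b) in
  vq tt (- (formQQ b b)%:~R / 2 + (formPQ lam b)%:~R) *
  pairing tt lam (th b) (thb b).

Definition qpoch (tt : K) (b : 'I_l -> nat) : K :=
  \prod_i \prod_(k < b i) (1 - vq tt (2 * (d i)%:R * k.+1%:R)).

End QuantumData.

(* the field K = C(v^(1/N)), with C = R[i] for the real numbers R *)
Notation KC R := {fraction {poly complex R}}.
Definition tC (R : realType) : KC R := FracField.tofrac ('X : {poly complex R}).

(* Main.v *)
Require Import Defs.
From HB Require Import structures.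
From mathcomp Require Import all_boot all_order all_algebra fraction.
From mathcomp Require Import complex reals.
From mathcomp Require Import zify ring.
From Stdlib Require Import ClassicalEpsilon FunctionalExtensionality.

(** A vector of a Verma module is a combination of words F_w 1 modulo the Serre
    relations, and after the substitution v -> 1/v the pairing is the symmetric
    Shapovalov form.  Pairing with a Whittaker vector evaluates a word by a
    twisted character, so [J] is such a character evaluated on theta.

    Orthogonality.  Reversing words turns the highest weight mu into
    -mu - 2 rho + wt and changes the sign of the action of the E_i.  Hence in
    the Verma module of highest weight kap the sum over gamma of suitable
    multiples of rev(thetabar'_gamma) theta_(B - gamma), with thetabar' of
    highest weight B - kap - 2 rho, is annihilated by all the E_i.  A singular
    vector would contradict uniqueness of the Whittaker vector, so the sum is 0;
    applying the character of thetabar says that the matrix with entries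
    J^(lam - a)_(a' - a) has the left inverse with entries
    J^(a' - lam - 2 rho)_(a' - a) e(a) / e(a'), where e is the exponential of the
    Casimir eigenvalue.  A left inverse of a square matrix is a right inverse,
    which is the first identity.

    Recursion.  Order the nodes compatibly with the orientation eps, which is
    acyclic since the form is positive definite.  A combination of the vectors
    F_1^(m_1) ... F_l^(m_l) theta_alpha (the Drinfeld Casimir element applied to
    theta) is again a Whittaker vector, hence equals theta, which says that J is
    an eigenvector of the operator with kernel e(alpha) / (q)_(beta - alpha).
    Together with the inverse matrix this is the second identity. *)

Set Implicit Arguments.
Unset Strict Implicit.
Unset Printing Implicit Defensive.

Import Order.TTheory GRing.Theory Num.Theory.
Local Open Scope ring_scope.

(** * Words and the Serre ideal *)

Section LinearForms.
Variables (l : nat) (K : fieldType).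
Implicit Types (x y : lc l K) (phi : seq 'I_l -> K) (u w : seq 'I_l).

(* Linear combinations of words are compared through the linear forms [phi] on
   them, so that linear operators act by precomposition on [phi]. *)
Definition ev phi x : K := \sum_(p <- x) p.1 * phi p.2.

Lemma ev_nil phi : ev phi [::] = 0.
Proof. by rewrite /ev big_nil. Qed.

Lemma ev_cons phi p x : ev phi (p :: x) = p.1 * phi p.2 + ev phi x.
Proof. by rewrite /ev big_cons. Qed.

Lemma ev_seq1 phi p : ev phi [:: p] = p.1 * phi p.2.
Proof. by rewrite ev_cons ev_nil addr0. Qed.

Lemma ev_cat phi x y : ev phi (x ++ y) = ev phi x + ev phi y.
Proof. by rewrite /ev big_cat. Qed.

Lemma ev_scale phi a x : ev phi (scale a x) = a * ev phi x.
Proof.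
by rewrite /ev /scale big_map mulr_sumr; apply: eq_bigr => p _; rewrite mulrA.
Qed.

Lemma ev_map phi g x : ev phi [seq (p.1, g p.2) | p <- x] = ev (phi \o g) x.
Proof. by rewrite /ev big_map. Qed.

Lemma ev_flatten (T : Type) (r : seq T) (F : T -> lc l K) phi :
  ev phi (flatten [seq F i | i <- r]) = \sum_(i <- r) ev phi (F i).
Proof.
elim: r => [|i r IH] /=; first by rewrite ev_nil big_nil.
by rewrite ev_cat IH big_cons.
Qed.

Lemma eq_ev phi psi x : (forall w, phi w = psi w) -> ev phi x = ev psi x.
Proof. by move=> e; apply: eq_bigr => p _; rewrite e. Qed.

Lemma eq_ev_in phi psi x (P : pred (K * seq 'I_l)) :
  all P x -> (forall p, P p -> phi p.2 = psi p.2) -> ev phi x = ev psi x.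
Proof.
move=> xP e; elim: x xP => [|p x IH] /=; first by rewrite !ev_nil.
by case/andP=> pP xP; rewrite !ev_cons e // IH.
Qed.

Lemma ev_const0 x : ev (fun=> 0) x = 0.
Proof. by rewrite /ev big1 // => p _; rewrite mulr0. Qed.

Lemma ev_funD phi psi x : ev (fun w => phi w + psi w) x = ev phi x + ev psi x.
Proof. by rewrite /ev -big_split; apply: eq_bigr => p _; rewrite mulrDr. Qed.

Lemma ev_funZ a phi x : ev (fun w => a * phi w) x = a * ev phi x.
Proof. by rewrite /ev mulr_sumr; apply: eq_bigr => p _; rewrite mulrCA. Qed.

Lemma ev_funN phi x : ev (fun w => - phi w) x = - ev phi x.
Proof. by rewrite -mulN1r -ev_funZ; apply: eq_ev => w; rewrite mulN1r. Qed.

Lemma ev_exchange (f : seq 'I_l -> seq 'I_l -> K) x y :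
  ev (fun u => ev (f u) y) x = ev (fun w => ev (f^~ w) x) y.
Proof.
rewrite /ev; under eq_bigr do rewrite mulr_sumr.
rewrite exchange_big /=; apply: eq_bigr => q _; rewrite mulr_sumr.
by apply: eq_bigr => p _; rewrite mulrCA.
Qed.

Lemma coef_ev x w : coef x w = ev (fun u => (u == w)%:R) x.
Proof.
rewrite /coef /ev big_mkcond; apply: eq_bigr => p _.
by case: eqP => _; rewrite ?mulr1 ?mulr0.
Qed.

Lemma ev_coef phi x (W : seq (seq 'I_l)) :
    uniq W -> all (fun p => p.2 \in W) x ->
  ev phi x = \sum_(w <- W) coef x w * phi w.
Proof.
move=> uW; elim: x => [_|p x IH] /=.
  by rewrite ev_nil big1 // => w _; rewrite coef_ev ev_nil mul0r.
case/andP=> pW xW; rewrite ev_cons IH //.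
under [RHS]eq_bigr do rewrite coef_ev ev_cons mulrDl -coef_ev.
rewrite big_split /=; congr (_ + _).
rewrite (bigD1_seq p.2) //= eqxx mulr1 big1 ?addr0 // => w.
by rewrite eq_sym => /negbTE ->; rewrite mulr0 mul0r.
Qed.

Lemma coef_eq0_ev phi x : (forall w, coef x w = 0) -> ev phi x = 0.
Proof.
move=> x0; rewrite (@ev_coef _ _ (undup (map snd x))) ?undup_uniq //.
  by rewrite big1 // => w _; rewrite x0 mul0r.
by apply/allP=> p px; rewrite mem_undup map_f.
Qed.

End LinearForms.

Section Serre.
Variables (l : nat) (A : 'M[int]_l) (d : 'I_l -> nat) (K : fieldType).
Variables (N : nat) (tt : K).
Local Notation word := (seq 'I_l).
Local Notation form := ((word -> K) -> K).
Implicit Types (f g : form) (phi : word -> K) (u w : word) (x y : lc l K).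

(* A vector is given by its values [f phi] at all the linear forms [phi]; it is
   in the ideal generated by the Serre relations. *)
Definition in_serre f : Prop :=
  exists s : seq (K * word * 'I_l * 'I_l * word),
    all (fun p => let '(_, _, i, j, _) := p in i != j) s /\
    forall phi, f phi = ev phi (flatten [seq serre_elt A d N tt p | p <- s]).

Lemma ev_serre_elt phi b u i j w :
  ev phi (serre_elt A d N tt (b, u, i, j, w)) =
  b * ev (fun z => phi (u ++ z ++ w)) (serre A d N tt i j).
Proof. by rewrite /serre_elt ev_scale (ev_map phi (fun z => u ++ z ++ w)). Qed.

(** [veq] tests coefficients only. A combination all of whose coefficients vanish is killed by every
    linear form, so the same family [s] serves in both directions. *)
Lemma veqP x y :
  veq A d N tt x y <-> in_serre (fun phi => ev phi x - ev phi y).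
Proof.
split=> [] [s [s_ne sP]]; exists s; (split; first exact: s_ne).
  move=> phi; apply/eqP; rewrite -subr_eq0; apply/eqP.
  set z := flatten _.
  have -> : ev phi x - ev phi y - ev phi z = ev phi (x ++ scale (-1) (y ++ z)).
    by rewrite ev_cat ev_scale ev_cat mulN1r opprD addrA.
  apply: coef_eq0_ev => w; rewrite coef_ev ev_cat ev_scale ev_cat -!coef_ev.
  by rewrite -sP mulN1r opprD addrA subrr.
by move=> w; rewrite !coef_ev sP.
Qed.

Lemma eq_in_serre f g : f =1 g -> in_serre f -> in_serre g.
Proof.
move=> e [s [s_ne sP]]; exists s; split; first exact: s_ne.
by move=> phi; rewrite -e sP.
Qed.

Lemma in_serre0 : in_serre (fun=> 0).
Proof. by exists [::]; split=> // phi; rewrite ev_nil. Qed.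

Lemma in_serreD f g :
  in_serre f -> in_serre g -> in_serre (fun phi => f phi + g phi).
Proof.
move=> [s [s_ne sP]] [t [t_ne tP]]; exists (s ++ t).
by rewrite all_cat s_ne t_ne; split=> // phi; rewrite map_cat flatten_cat ev_cat sP tP.
Qed.

Lemma in_serreZ a f : in_serre f -> in_serre (fun phi => a * f phi).
Proof.
move=> [s [s_ne sP]].
exists [seq (let '(b, u, i, j, w) := p in (a * b, u, i, j, w)) | p <- s]; split.
  by rewrite all_map; apply: sub_all s_ne => -[[[[b u] i] j] w].
move=> phi; rewrite sP -map_comp !ev_flatten mulr_sumr.
by apply: eq_bigr => -[[[[b u] i] j] w] _; rewrite !ev_serre_elt mulrA.
Qed.

Lemma in_serreB f g :
  in_serre f -> in_serre g -> in_serre (fun phi => f phi - g phi).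
Proof.
move=> ff /(in_serreZ (-1)) gg; apply: eq_in_serre (in_serreD ff gg) => phi.
by rewrite mulN1r.
Qed.

Lemma in_serre_sum (T : Type) (r : seq T) (P : pred T) (F : T -> form) :
  (forall i, P i -> in_serre (F i)) ->
  in_serre (fun phi => \sum_(i <- r | P i) F i phi).
Proof.
move=> FP; elim: r => [|i r IH].
  by apply: eq_in_serre in_serre0 => phi; rewrite big_nil.
case Pi: (P i); last by apply: eq_in_serre IH => phi; rewrite big_cons Pi.
by apply: eq_in_serre (in_serreD (FP i Pi) IH) => phi; rewrite big_cons Pi.
Qed.

Lemma in_serre_lc (F : word -> form) x (P : pred (K * word)) :
    all P x -> (forall p, P p -> in_serre (F p.2)) ->
  in_serre (fun phi => ev (fun w => F w phi) x).
Proof.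
move=> xP FP; elim: x xP => [|p x IH] /=.
  by move=> _; apply: eq_in_serre in_serre0 => phi; rewrite ev_nil.
case/andP=> pP /IH xs; apply: eq_in_serre (in_serreD (in_serreZ p.1 (FP p pP)) xs).
by move=> phi; rewrite ev_cons.
Qed.

Lemma in_serre_mul u w f :
  in_serre f -> in_serre (fun phi => f (fun z => phi (u ++ z ++ w))).
Proof.
move=> [s [s_ne sP]].
exists [seq (let '(b, u', i, j, w') := p in (b, u ++ u', i, j, w' ++ w)) | p <- s].
split.
  by rewrite all_map; apply: sub_all s_ne => -[[[[b u'] i] j] w'].
move=> phi; rewrite sP -map_comp !ev_flatten.
apply: eq_bigr => -[[[[b u'] i] j] w'] _; rewrite !ev_serre_elt.
by congr (_ * _); apply: eq_ev => z; rewrite -!catA.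
Qed.

Lemma in_serre_gen u i j w : i != j ->
  in_serre (fun phi => ev (fun z => phi (u ++ z ++ w)) (serre A d N tt i j)).
Proof.
move=> ij; exists [:: (1, u, i, j, w)]; split=> [|phi]; first by rewrite /= ij.
by rewrite ev_flatten big_seq1 ev_serre_elt mul1r.
Qed.

(** [D] is the transpose of a linear operator on vectors. Since [f] is a combination of the products
    u s w with s a Serre element, it is enough to control the operator on these. *)
Lemma in_serre_stable (D : (word -> K) -> word -> K) f :
    (forall u i j w, i != j ->
       in_serre (fun phi =>
         ev (fun z => D phi (u ++ z ++ w)) (serre A d N tt i j))) ->
  in_serre f -> in_serre (fun phi => f (D phi)).
Proof.
move=> DP [s [s_ne sP]].
have {}s_ne : forall p, List.In p s -> let '(_, _, i, j, _) := p in i != j.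
  elim: s s_ne {sP} => //= q s IH /andP[qP /IH sP] p [<-|/sP //].
  by move: qP.
apply: (@eq_in_serre (fun phi => ev (D phi) (flatten [seq serre_elt A d N tt p | p <- s]))).
  by move=> phi; rewrite sP.
elim: s s_ne {sP} => [_|[[[[b u] i] j] w] s IH sP].
  by apply: eq_in_serre in_serre0 => phi; rewrite ev_nil.
have ij : i != j by have := sP (b, u, i, j, w) (or_introl erefl).
have sP' : forall p, List.In p s -> let '(_, _, i, j, _) := p in i != j.
  by move=> p ps; apply: sP; right.
apply: eq_in_serre (in_serreD (in_serreZ b (DP u i j w ij)) (IH sP')) => phi.
by rewrite [RHS]ev_flatten big_cons ev_serre_elt -ev_flatten.
Qed.

Lemma in_serre_vanish phi f :
    (forall u i j w, i != j ->
       ev (fun z => phi (u ++ z ++ w)) (serre A d N tt i j) = 0) ->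
  in_serre f -> f phi = 0.
Proof.
move=> phi0 [s [s_ne ->]]; elim: s s_ne => [|[[[[b u] i] j] w] s IH].
  by rewrite ev_nil.
by case/andP=> ij /IH e; rewrite ev_flatten big_cons ev_serre_elt -ev_flatten phi0 // mulr0 add0r.
Qed.

End Serre.

(** * Quantum integers and the Shapovalov form *)

Section QuantumIntegers.
Variables (l : nat) (d : 'I_l -> nat) (K : fieldType) (N : nat) (tt : K).
Hypothesis tt_neq0 : tt != 0.
Hypothesis tt_order : forall n, (0 < n)%N -> tt ^+ n != 1.
Hypothesis N_gt0 : (0 < N)%N.
Hypothesis d_gt0 : forall i, (0 < d i)%N.
Local Notation v := (tt ^+ N).
Local Notation q := (qint d N tt).

Lemma vq_int (n : int) : vq N tt n%:~R = v ^ n.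
Proof.
by rewrite /vq -[N%:R]mulrz_nat -intrM numq_int mulrC exprnP exprz_exp natz.
Qed.

Lemma v_neq0 : v != 0. Proof. by rewrite expf_neq0. Qed.

Lemma vX_neq0 (n : int) : v ^ n != 0. Proof. by rewrite expfz_neq0 ?v_neq0. Qed.

Lemma vXD (m n : int) : v ^ (m + n) = v ^ m * v ^ n.
Proof. by rewrite expfzDr ?v_neq0. Qed.

Lemma vX_neq1 (n : nat) : (0 < n)%N -> v ^ n%:Z != 1.
Proof. by move=> n0; rewrite -exprnP -exprM tt_order // muln_gt0 N_gt0. Qed.

Definition vpow (i : 'I_l) (n : int) : K := v ^ ((d i)%:Z * n).
Local Notation vi := vpow.

Lemma viD i m n : vi i (m + n) = vi i m * vi i n.
Proof. by rewrite /vpow mulrDr vXD. Qed.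

Lemma viN i n : vi i (- n) = (vi i n)^-1.
Proof. by rewrite /vpow mulrN -invr_expz. Qed.

Lemma vi0 i : vi i 0 = 1. Proof. by rewrite /vpow mulr0. Qed.

Lemma vi_neq0 i n : vi i n != 0. Proof. exact: vX_neq0. Qed.

Lemma vi_neq1 i (n : nat) : (0 < n)%N -> vi i n%:Z != 1.
Proof. by move=> n0; rewrite /vpow -PoszM vX_neq1 // muln_gt0 d_gt0. Qed.

Lemma vi_subV_neq0 i (n : nat) : (0 < n)%N -> vi i n%:Z - (vi i n%:Z)^-1 != 0.
Proof.
move=> n0; apply/eqP => /eqP; rewrite subr_eq0 => /eqP e.
have := @vi_neq1 i (n + n) _; rewrite addn_gt0 n0 => /(_ isT).
by rewrite PoszD viD {1}e mulVf ?vi_neq0 // eqxx.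
Qed.

Lemma qintE i (n : int) :
  q i n = (vi i n - (vi i n)^-1) / (vi i 1 - (vi i 1)^-1).
Proof.
rewrite /qint -[(d i)%:R]mulrz_nat -intrM -!mulrNz !vq_int.
by rewrite -!viN /vpow natz mulr1 !mulrN mulr1.
Qed.

Lemma qint0 i : q i 0 = 0.
Proof. by rewrite qintE vi0 invr1 subrr mul0r. Qed.

Lemma qintN i n : q i (- n) = - q i n.
Proof. by rewrite !qintE viN invrK -mulNr opprB. Qed.

Lemma qint_neq0 i (n : nat) : (0 < n)%N -> q i n%:Z != 0.
Proof.
by move=> n0; rewrite qintE mulf_neq0 ?invr_neq0 ?vi_subV_neq0 // (@vi_subV_neq0 i 1).
Qed.

(** Induction step for [ev_Eword_nseq], the sl_2 formula for E F^m on a vector of highest weight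
    h. *)
Lemma qint_step i (m h : int) :
  q i m * q i (h - m + 1) + q i (h - m - m) = q i (m + 1) * q i (h - m).
Proof.
rewrite !qintE !viD !viN.
have := @vi_subV_neq0 i 1 isT; have := vi_neq0 i 1.
have := vi_neq0 i m; have := vi_neq0 i h.
move: (vi i 1) (vi i m) (vi i h) => a x y y0 x0 a0 a1.
field; rewrite a0 x0 y0 /= andbT; apply: contraNneq a1 => e.
have -> : a - a^-1 = (a ^+ 2 - 1) / a by field.
by rewrite expr2 e mul0r.
Qed.

Lemma qfact0 i : qfact d N tt i 0 = 1.
Proof. by rewrite /qfact big_ord0. Qed.

Lemma qfactS i n : qfact d N tt i n.+1 = qfact d N tt i n * q i n.+1%:Z.
Proof. by rewrite /qfact big_ord_recr. Qed.

Lemma qfact_neq0 i n : qfact d N tt i n != 0.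
Proof. by apply/prodf_neq0 => k _; rewrite qint_neq0. Qed.

Lemma qbin_sym i n r : (r <= n)%N -> qbin d N tt i n (n - r) = qbin d N tt i n r.
Proof. by move=> rn; rewrite /qbin subKn // [_ * qfact _ _ _ _ r]mulrC. Qed.

Lemma qbin0 i n : qbin d N tt i n 0 = 1.
Proof. by rewrite /qbin qfact0 mul1r subn0 divff ?qfact_neq0. Qed.

Lemma qbinn i n : qbin d N tt i n n = 1.
Proof. by rewrite -{2}(@subn0 n) qbin_sym // qbin0. Qed.

Lemma qbin_next i n r : (r < n)%N ->
  qbin d N tt i n r.+1 * q i r.+1%:Z = qbin d N tt i n r * q i (n - r)%:Z.
Proof.
move=> rn; rewrite /qbin -(subnSK rn) !qfactS (subnSK rn).
have := qfact_neq0 i r; have := qfact_neq0 i (n - r.+1)%N.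
have := @qint_neq0 i r.+1 isT; have : q i (n - r)%:Z != 0 by rewrite qint_neq0 // subn_gt0.
move: (q i _) (q i _) (qfact _ _ _ _ _) (qfact _ _ _ _ _) (qfact _ _ _ _ _).
by move=> a b c e f b0 a0 f0 e0; field; rewrite a0 b0 f0 e0.
Qed.

(** After multiplication by [r+1] both sides are multiples of the binomial of n and r, and the claim
    becomes [n+1] = v_i^(r+1) [n-r] + v_i^(r-n) [r+1]. *)
Lemma qbin_pascal i n r : (r < n)%N ->
  qbin d N tt i n.+1 r.+1 =
  vi i r.+1%:Z * qbin d N tt i n r.+1 + vi i (r%:Z - n%:Z) * qbin d N tt i n r.
Proof.
move=> rn; have nr := qbin_next i rn.
have q1 : q i r.+1%:Z != 0 by rewrite qint_neq0.
apply: (mulIf q1); rewrite [RHS]mulrDl -[vi i r.+1%:Z * _ * _]mulrA nr.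
have -> : qbin d N tt i n.+1 r.+1 * q i r.+1%:Z = qbin d N tt i n r * q i n.+1%:Z.
  rewrite /qbin qfactS [qfact _ _ _ _ r.+1]qfactS subSS.
  have := qfact_neq0 i r; have := qfact_neq0 i (n - r)%N; move: q1.
  move: (q i _) (q i _) (qfact _ _ _ _ _) (qfact _ _ _ _ _) (qfact _ _ _ _ _).
  by move=> a b c e f a0 b0 c0; field; rewrite a0 b0 c0.
transitivity (qbin d N tt i n r *
  (vi i r.+1%:Z * q i (n - r)%:Z + vi i (r%:Z - n%:Z) * q i r.+1%:Z)); last by ring.
congr (_ * _).
have -> : (n - r)%:Z = n%:Z - r%:Z by rewrite subzn // ltnW.
have -> : n.+1%:Z = n%:Z + 1 by lia.
have -> : r.+1%:Z = r%:Z + 1 by lia.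
rewrite !qintE !viD !viN.
have := @vi_subV_neq0 i 1 isT; have := vi_neq0 i 1.
have := vi_neq0 i n; have := vi_neq0 i r.
move: (vi i 1) (vi i n) (vi i r) => a x y y0 x0 a0 a1.
field; rewrite a0 x0 y0 /= andbT; apply: contraNneq a1 => e.
have -> : a - a^-1 = (a ^+ 2 - 1) / a by field.
by rewrite expr2 e mul0r.
Qed.

(* The q-binomial theorem gives the sum as the product of the
   1 - z v_i^(n-1-2k), k < n; only its recursive step is needed here. *)
Lemma qbin_alt_sumS i n (z : K) :
  \sum_(r < n.+2) (-1) ^+ r * qbin d N tt i n.+1 r * z ^+ r =
  (1 - z * vi i (- n%:Z)) *
    \sum_(r < n.+1) (-1) ^+ r * qbin d N tt i n r * (z * vi i 1) ^+ r.
Proof.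
have viX k : vi i 1 ^+ k = vi i k%:Z.
  by elim: k => [|k IH]; rewrite ?vi0 // exprS IH -viD.
pose b k := (-1) ^+ k * qbin d N tt i n k * (z * vi i 1) ^+ k.
have E1 : \sum_(r < n.+1) b r = 1 + \sum_(r < n) b r.+1.
  by rewrite big_ord_recl {1}/b qbin0 !expr0 !mulr1.
have E2 : \sum_(r < n.+1) b r = \sum_(r < n) b r + b n by rewrite big_ord_recr.
rewrite mulrBl mul1r {1}E1 E2 big_ord_recl big_ord_recr /= qbin0 !expr0 !mulr1.
rewrite /bump /= !add1n qbinn.
have -> : \sum_(r < n) (-1) ^+ (bump 0 r) * qbin d N tt i n.+1 (bump 0 r) *
    z ^+ (bump 0 r) =
    \sum_(r < n) b r.+1 - z * vi i (- n%:Z) * \sum_(r < n) b r.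
  rewrite mulr_sumr -sumrB; apply: eq_bigr => r _.
  rewrite /bump /= !add1n qbin_pascal // /b !exprMn !viX.
  have -> : vi i (r%:Z - n%:Z) = vi i (- n%:Z) * vi i r by rewrite -viD addrC.
  by rewrite !exprS; ring.
have -> : (-1) ^+ n.+1 * 1 * z ^+ n.+1 = - (z * vi i (- n%:Z) * b n).
  have e : vi i (- n%:Z) * vi i n%:Z = 1 by rewrite -viD addNr vi0.
  rewrite /b qbinn exprMn viX !exprS.
  transitivity (- (-1) ^+ n * z * z ^+ n * (vi i (- n%:Z) * vi i n%:Z)); last by ring.
  by rewrite e; ring.
by ring.
Qed.

(** The factor 1 - z v_i^(-n) of [qbin_alt_sumS] vanishes at z = v_i^n. *)
Lemma qbin_alt_sum0 i n :
  \sum_(r < n.+2) (-1) ^+ r * qbin d N tt i n.+1 r * vi i (n%:Z * r%:Z) = 0.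
Proof.
have viX k : vi i (n%:Z * k%:Z) = vi i n ^+ k.
  elim: k => [|k IH]; first by rewrite mulr0 vi0.
  by rewrite exprS -IH -viD; congr (vi i _); lia.
under eq_bigr => r _ do rewrite viX.
by rewrite qbin_alt_sumS -viD subrr vi0 subrr mul0r.
Qed.

(** Summing in the reverse order, r to n + 1 - r, reduces this to [qbin_alt_sum0] because the
    binomials are symmetric. *)
Lemma qbin_alt_sum0N i n :
  \sum_(r < n.+2) (-1) ^+ r * qbin d N tt i n.+1 r * vi i (- (n%:Z * r%:Z)) = 0.
Proof.
rewrite (reindex_inj rev_ord_inj) /=.
transitivity ((-1) ^+ n.+1 * vi i (- (n%:Z * n.+1%:Z)) *
   \sum_(r < n.+2) (-1) ^+ r * qbin d N tt i n.+1 r * vi i (n%:Z * r%:Z)).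
  rewrite mulr_sumr; apply: eq_bigr => r _; rewrite subSS.
  have rn : (r <= n.+1)%N by rewrite -ltnS.
  rewrite qbin_sym //.
  have -> : vi i (- (n%:Z * (n.+1 - r)%:Z)) =
            vi i (- (n%:Z * n.+1%:Z)) * vi i (n%:Z * r%:Z).
    by rewrite -viD; congr (vi i _); rewrite -subzn //; ring.
  have -> : (-1) ^+ (n.+1 - r) = (-1) ^+ n.+1 * (-1) ^+ r :> K.
    move: (nat_of_ord r) rn => k eigenN.
    by rewrite -{2}(subnK eigenN) exprD -mulrA -exprMn mulrNN mulr1 expr1n mulr1.
  by ring.
by rewrite qbin_alt_sum0 mulr0.
Qed.

End QuantumIntegers.

(** * Raising operators on words, stability of the Serre ideal, Shapovalov form *)

Section Verma.
Variables (l : nat) (A : 'M[int]_l) (d : 'I_l -> nat) (K : fieldType).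
Variables (N : nat) (tt : K).
Hypothesis tt_neq0 : tt != 0.
Hypothesis tt_order : forall n, (0 < n)%N -> tt ^+ n != 1.
Hypothesis N_gt0 : (0 < N)%N.
Hypothesis d_gt0 : forall i, (0 < d i)%N.
Hypothesis A_diag : forall i, A i i = 2.
Hypothesis A_le0 : forall i j, i != j -> A i j <= 0.
Hypothesis A_sym : forall i j, (d i)%:Z * A i j = (d j)%:Z * A j i.
Local Notation word := (seq 'I_l).
Local Notation q := (qint d N tt).
Local Notation EW := (Eword A d N tt).
Local Notation inI := (in_serre A d N tt).
Implicit Types (phi : word -> K) (kap : 'I_l -> int) (b g : 'I_l -> nat).

Definition wt (w : word) : 'I_l -> nat := fun k => count_mem k w.
Definition addQ b g : 'I_l -> nat := fun k => (b k + g k)%N.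

Lemma rootw0 i : rootw A (@zeroQ l) i = 0.
Proof. by rewrite /rootw big1 // => j _; rewrite mul0r. Qed.

Lemma rootwD b g i : rootw A (addQ b g) i = rootw A b i + rootw A g i.
Proof. by rewrite /rootw -big_split; apply: eq_bigr => j _; rewrite PoszD mulrDl. Qed.

Lemma rootw_addroot b j i : rootw A (addroot b j) i = rootw A b i + A i j.
Proof.
rewrite /rootw /addroot; under eq_bigr do rewrite PoszD mulrDl.
rewrite big_split /=; congr (_ + _); rewrite (bigD1 j) //= eqxx mul1r big1 ?addr0 //.
by move=> k /negbTE ->; rewrite mul0r.
Qed.

Lemma wt_cons j w : wt (j :: w) = addroot (wt w) j.
Proof.
by apply: functional_extensionality => k; rewrite /wt /addroot /= eq_sym addnC.
Qed.

Lemma wt_cat u w : wt (u ++ w) = addQ (wt u) (wt w).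
Proof. by apply: functional_extensionality => k; rewrite /wt /addQ count_cat. Qed.

Lemma wt_nil : wt [::] = @zeroQ l. Proof. by []. Qed.

Lemma wt_rev w : wt (rev w) = wt w.
Proof. by apply: functional_extensionality => k; rewrite /wt count_rev. Qed.

Lemma wt_nseq m i k : wt (nseq m i) k = ((k == i) * m)%N.
Proof. by rewrite /wt count_nseq /= eq_sym. Qed.

Lemma rootw_cat u w i :
  rootw A (wt (u ++ w)) i = rootw A (wt u) i + rootw A (wt w) i.
Proof. by rewrite wt_cat rootwD. Qed.

Lemma rootw_nseq m j i : rootw A (wt (nseq m j)) i = m%:Z * A i j.
Proof.
elim: m => [|m IH]; first by rewrite rootw0 mul0r.
by rewrite /= wt_cons rootw_addroot IH intS mulrDl mul1r addrC.
Qed.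

Lemma ev_Eword_cons phi i kap j w :
  ev phi (EW i kap (j :: w)) =
    ev (fun x => phi (j :: x)) (EW i kap w) +
    (if j == i then q i (kap i - rootw A (wt w) i) * phi w else 0).
Proof.
rewrite /= ev_cat (ev_map phi (cons j)); congr (_ + _).
by case: ifP => _; rewrite ?ev_nil // ev_seq1.
Qed.

Lemma ev_Eword_cat phi i kap kap' u w :
    kap' i = kap i - rootw A (wt w) i ->
  ev phi (EW i kap (u ++ w)) =
    ev (fun x => phi (x ++ w)) (EW i kap' u) + ev (fun x => phi (u ++ x)) (EW i kap w).
Proof.
move=> e; elim: u phi => [|j u IH] phi; first by rewrite ev_nil add0r.
rewrite cat_cons !ev_Eword_cons IH addrAC; congr (_ + _ + _).
by case: ifP => // _; rewrite rootw_cat e opprD addrA addrAC.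
Qed.

(* Reversing words turns the highest weight mu into -mu - 2rho + wt u and
   changes the sign of the action. *)
Lemma ev_Eword_rev phi i mu mu' u :
    mu i + mu' i + 2 = rootw A (wt u) i ->
  ev phi (EW i mu (rev u)) = - ev (fun x => phi (rev x)) (EW i mu' u).
Proof.
elim: u phi mu => [|j u IH] phi mu e; first by rewrite !ev_nil oppr0.
rewrite rev_cons -cats1 (@ev_Eword_cat _ _ _ (fun k => mu k - A k j)); last first.
  by rewrite (rootw_nseq 1) mul1r.
rewrite (IH (fun x => phi (x ++ [:: j]))); last first.
  by move: e; rewrite wt_cons rootw_addroot => e; lia.
rewrite [in RHS]ev_Eword_cons opprD; congr (_ + _).
  by congr (- _); apply: eq_ev => x; rewrite rev_cons cats1.
rewrite ev_Eword_cons ev_nil add0r; case: eqP => [ji|_]; last by rewrite oppr0.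
rewrite rootw0 subr0 cats0 -mulNr -qintN; congr (q i _ * _).
by move: e; rewrite wt_cons rootw_addroot -ji A_diag => e; lia.
Qed.

Lemma Eword_perm i kap w : all (fun p => perm_eq (i :: p.2) w) (EW i kap w).
Proof.
elim: w => //= j w IH; rewrite all_cat; apply/andP; split; last first.
  by case: eqP => //= ->; rewrite perm_refl.
rewrite all_map; apply: sub_all IH => p /= shap_word.
by rewrite -[i :: _]/([:: i] ++ [:: j] ++ p.2) perm_catCA /= perm_cons.
Qed.

Lemma ev_Eword_notin phi i kap w : i \notin w -> ev phi (EW i kap w) = 0.
Proof.
elim: w phi => [|j w IH] phi; first by rewrite ev_nil.
rewrite inE negb_or ev_Eword_cons => /andP[ij /IH ->].
by rewrite eq_sym (negbTE ij) addr0.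
Qed.

(** The sl_2 formula E F^m 1 = [m] [kap_i - m + 1] F^(m-1) 1. At m = 0 the truncated predecessor is
    harmless because [0] = 0. *)
Lemma ev_Eword_nseq phi i kap m :
  ev phi (EW i kap (nseq m i)) = q i m%:Z * q i (kap i - m%:Z + 1) * phi (nseq m.-1 i).
Proof.
elim: m phi => [|m IH] phi; first by rewrite ev_nil qint0 !mul0r.
rewrite [nseq _ _]/= ev_Eword_cons IH eqxx rootw_nseq A_diag /=.
have -> : (m.+1%:Z : int) = m%:Z + 1 by lia.
have -> : kap i - (m%:Z + 1) + 1 = kap i - m%:Z by lia.
have -> : kap i - m%:Z * 2 = kap i - m%:Z - m%:Z by lia.
rewrite -(qint_step tt_neq0 tt_order) // mulrDl; congr (_ + _).
by case: m {IH} => [|m] //=; rewrite qint0 // !mul0r.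
Qed.

Lemma ev_serre_sum phi i j :
  ev phi (serre A d N tt i j) =
  \sum_(r < (`|1 - A i j|%N).+1)
     (-1) ^+ r * qbin d N tt i `|1 - A i j|%N r *
     phi (nseq (`|1 - A i j|%N - r) i ++ j :: nseq r i).
Proof. by rewrite /ev /serre big_map -(subn0 _.+1) -/(index_iota _ _) big_mkord. Qed.

Lemma absz_serre i j : i != j -> exists m, `|1 - A i j|%N = m.+1 /\ A i j = - m%:Z.
Proof. by move=> /A_le0 Aij; exists `|A i j|%N; lia. Qed.

(* The raising operators kill the Serre elements in the free algebra already. *)
Lemma ev_Eword_serre phi i j k kap : i != j ->
  ev (fun x => ev phi (EW k kap x)) (serre A d N tt i j) = 0.
Proof.
move=> ij; have [m [nE AE]] := absz_serre ij; rewrite ev_serre_sum nE.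
have E r x : ev phi (EW k kap (nseq x i ++ j :: nseq r i)) =
    ev (fun z => phi (z ++ j :: nseq r i))
       (EW k (fun t => kap t - (A t j + r%:Z * A t i)) (nseq x i)) +
    (ev (fun z => phi (nseq x i ++ j :: z)) (EW k kap (nseq r i)) +
    (if j == k then q k (kap k - r%:Z * A k i) * phi (nseq x i ++ nseq r i) else 0)).
  rewrite (@ev_Eword_cat _ _ _ (fun t => kap t - (A t j + r%:Z * A t i))); last first.
    by rewrite wt_cons rootw_addroot rootw_nseq [_ + A k j]addrC.
  by rewrite ev_Eword_cons rootw_nseq.
under eq_bigr do rewrite E.
(* For k different from i only the letter j can be removed, so only k = j matters. What remains is a
   multiple of F_i^(m+1), and the contributions of K_j and of its inverse are the two alternating
   sums of q-binomials, both zero. *)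
have [ki|ki] := eqVneq k i; last first.
  have nin x : k \notin nseq x i by rewrite mem_nseq negb_and ki orbT.
  under eq_bigr do rewrite !ev_Eword_notin // !add0r.
  have [jk|jk] := eqVneq j k; last by rewrite big1 // => r _; rewrite mulr0.
  rewrite -jk.
  have VE r : q j (kap j - r%:Z * A j i) =
     (vpow d N tt j (kap j) * vpow d N tt i (m%:Z * r%:Z) -
      vpow d N tt j (- kap j) * vpow d N tt i (- (m%:Z * r%:Z)))
       / (vpow d N tt j 1 - (vpow d N tt j 1)^-1).
    rewrite qintE // -viN // opprD opprK !viD //.
    have e : (d i)%:Z * (m%:Z * r%:Z) = - ((d j)%:Z * (r%:Z * A j i)).
      transitivity (- (r%:Z * ((d j)%:Z * A j i))); last by ring.
      by rewrite -A_sym AE; ring.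
    by congr ((_ * _ - _ * _) / _); rewrite /vpow ?mulrN e ?opprK.
  transitivity (phi (nseq m.+1 i) / (vpow d N tt j 1 - (vpow d N tt j 1)^-1) *
    (vpow d N tt j (kap j) * (\sum_(r < m.+2) (-1) ^+ r * qbin d N tt i m.+1 r * vpow d N tt i (m%:Z * r%:Z))
    - vpow d N tt j (- kap j) * (\sum_(r < m.+2) (-1) ^+ r * qbin d N tt i m.+1 r * vpow d N tt i (- (m%:Z * r%:Z))))).
    rewrite !mulr_sumr -sumrB mulr_sumr; apply: eq_bigr => r _; rewrite VE.
    by rewrite -nseqD subnK -1?ltnS //; ring.
  by rewrite qbin_alt_sum0 // qbin_alt_sum0N // !mulr0 subrr mulr0.
(* For k = i the letter j stays and E_i shortens one of the two strings of F_i. The term r from the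
   left string cancels the term r + 1 from the right one, by [qbin_next]. *)
rewrite ki eq_sym (negbTE ij) in E *.
under eq_bigr do rewrite addr0 !ev_Eword_nseq mulrDr.
rewrite big_split /= big_ord_recr /= subnn qint0 // !mul0r mulr0 addr0.
rewrite [X in _ + X]big_ord_recl /= qint0 // !mul0r mulr0 add0r.
rewrite -big_split big1 // => r _ /=; rewrite /bump /= add1n subSS.
have rn : (r < m.+1)%N by [].
have e := qbin_next tt_neq0 tt_order N_gt0 d_gt0 i rn.
have -> : (m.+1 - r).-1 = (m - r)%N by lia.
have -> : kap i - (A i j + r%:Z * A i i) - (m.+1 - r)%N%:Z + 1 = kap i - r%:Z.
  by rewrite AE A_diag; lia.
have -> : kap i - r.+1%:Z + 1 = kap i - r%:Z by lia.
rewrite add0n exprS; move: (phi _) => a.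
transitivity ((-1) ^+ r * (qbin d N tt i m.+1 r * q i (m.+1 - r)%:Z -
    qbin d N tt i m.+1 r.+1 * q i r.+1%:Z) * q i (kap i - r%:Z) * a); first by ring.
by rewrite e subrr mulr0 !mul0r.
Qed.

(** By the Leibniz rule [ev_Eword_cat], E_k hits u, the Serre element, or w. The middle contribution
    vanishes by [ev_Eword_serre], and the outer ones leave the Serre element intact. *)
Lemma in_serre_Eword k kap f :
  inI f -> inI (fun phi => f (fun x => ev phi (EW k kap x))).
Proof.
apply: (@in_serre_stable _ _ _ _ _ _ (fun phi x => ev phi (EW k kap x))).
move=> u i j w ij.
pose kw := fun t => kap t - rootw A (wt w) t.
pose m := `|1 - A i j|%N.
(* All words of a Serre element have weight m alpha_i + alpha_j, so the action on u sees the same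
   highest weight [ks] in every term. *)
pose ks t := kw t - (m%:Z * A t i + A t j).
have wts r : (r <= m)%N -> forall t,
    rootw A (wt (nseq (m - r) i ++ j :: nseq r i)) t = m%:Z * A t i + A t j.
  move=> rm t; rewrite rootw_cat wt_cons rootw_addroot !rootw_nseq addrA -mulrDl.
  by rewrite -PoszD subnK.
have E phi : ev (fun x => ev phi (EW k kap (u ++ x ++ w))) (serre A d N tt i j) =
   ev (fun z => ev (fun x => phi (z ++ x ++ w)) (serre A d N tt i j)) (EW k ks u) +
   ev (fun z => ev (fun x => phi (u ++ x ++ z)) (serre A d N tt i j)) (EW k kap w).
  rewrite -!(ev_exchange _ (serre _ _ _ _ _ _)) -ev_funD.
  rewrite -[RHS]addr0 -(@ev_Eword_serre (fun x => phi (u ++ x ++ w)) i j k kw ij) -ev_funD.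
  rewrite !ev_serre_sum; apply: eq_bigr => r _; congr (_ * _).
  have rm : (r <= m)%N by rewrite -ltnS.
  set s := nseq _ i ++ _; rewrite (@ev_Eword_cat _ k kap ks u (s ++ w)); last first.
    by rewrite rootw_cat (wts _ rm) /ks /kw; ring.
  rewrite (@ev_Eword_cat _ k kap kw s w) //.
  by rewrite -!addrA; congr (_ + _); rewrite addrC.
apply: eq_in_serre (fun phi => esym (E phi)) _.
by apply: in_serreD; apply: (@in_serre_lc _ _ _ _ _ _ _ _ predT) => [|p _];
  rewrite ?all_predT //; apply: in_serre_gen.
Qed.

(** Reversal multiplies the Serre element of i and j by (-1)^(1 - a_ij), by the symmetry of the
    q-binomials. *)
Lemma in_serre_rev f : inI f -> inI (fun phi => f (fun x => phi (rev x))).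
Proof.
apply: (@in_serre_stable _ _ _ _ _ _ (fun phi x => phi (rev x))) => u i j w ij.
have := in_serreZ ((-1) ^+ `|1 - A i j|%N) (in_serre_gen A d N tt (rev w) (rev u) ij).
apply: eq_in_serre => phi; rewrite !ev_serre_sum.
rewrite [RHS](reindex_inj rev_ord_inj) mulr_sumr /=; apply: eq_bigr => r _.
rewrite subSS; set m := `|_|%N; have rm : (r <= m)%N by rewrite -ltnS.
rewrite subKn // qbin_sym // !rev_cat rev_cons !rev_nseq cat_rcons -!catA /=.
have e : (-1) ^+ m * (-1) ^+ r = (-1) ^+ (m - r) :> K.
  move: (nat_of_ord r) rm => k km.
  by rewrite -{1}(subnK km) exprD -mulrA -exprMn mulrNN mulr1 expr1n mulr1.
by rewrite !mulrA e.
Qed.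

(** Shapovalov product of F_w 1 and F_u 1: the raising operators of the letters of w, the first
    letter first, are applied to F_u 1 and the coefficient of 1 is read off. *)
Fixpoint shap_word kap (w : word) : word -> K :=
  match w with
  | [::] => fun u => (u == [::])%:R
  | j :: w' => fun u => ev (shap_word kap w') (EW j kap u)
  end.

Lemma shap_word_perm kap w u : ~~ perm_eq w u -> shap_word kap w u = 0.
Proof.
elim: w u => [|j w IH] u /=.
  by case: u => [|? ?] //=.
move=> wu; rewrite (eq_ev_in (Eword_perm j kap u) (psi := fun=> 0)) ?ev_const0 //.
move=> p pu; rewrite IH //; apply: contra wu => wp.
by apply: perm_trans pu; rewrite perm_cons.
Qed.

(** Contravariance in the second argument. In the induction the two raising operators act on
    different arguments and can be exchanged. *)
Lemma shap_word_consr kap w j u :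
  shap_word kap w (j :: u) = ev (fun x => shap_word kap x u) (EW j kap w).
Proof.
elim: w u => [|i w IH] u; first by rewrite ev_nil.
rewrite [LHS]/= ev_Eword_cons ev_Eword_cons /=.
rewrite (@eq_ev _ _ _ (fun x => ev (fun y => shap_word kap y x) (EW j kap w))); last first.
  by move=> x; rewrite IH.
rewrite ev_exchange; congr (_ + _).
rewrite eq_sym; case: eqP => // ij.
(* The diagonal terms carry the weights of u and of w; these agree whenever the product of w and u
   is nonzero. *)
have [wu|wu] := boolP (perm_eq w u); last by rewrite shap_word_perm ?mulr0.
have -> : wt u = wt w.
  by apply: functional_extensionality => k; rewrite /wt (permP wu).
by rewrite ij.
Qed.

Lemma shap_word_sym kap w u : shap_word kap w u = shap_word kap u w.
Proof.
elim: w u => [|j w IH] u; last first.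
  by rewrite shap_word_consr /=; apply: eq_ev => x; rewrite IH.
by case: u => [|i u] //=; rewrite ev_nil.
Qed.

Definition shapovalov kap x y : K := ev (fun w => ev (shap_word kap w) y) x.

Lemma shapovalov_sym kap x y : shapovalov kap x y = shapovalov kap y x.
Proof.
rewrite /shapovalov ev_exchange; apply: eq_ev => w.
by apply: eq_ev => u; rewrite shap_word_sym.
Qed.

(** The raising operators preserve the ideal, and no Serre relation has a component on the empty
    word; so the form descends to the Verma module. *)
Lemma in_serre_shap_word kap w f : inI f -> f (shap_word kap w) = 0.
Proof.
elim: w f => [|j w IH] f If /=; last first.
  exact: (IH (fun phi => f (fun x => ev phi (EW j kap x))) (in_serre_Eword j kap If)).
apply: in_serre_vanish If => u i j w _.
rewrite ev_serre_sum big1 // => r _; case: u => [|? ?]; last by rewrite mulr0.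
by case: (nseq _ _) => [|? ?]; rewrite mulr0.
Qed.

Lemma in_serre_shapovalov kap f y : inI f -> f (fun w => ev (shap_word kap w) y) = 0.
Proof.
move=> If.
have -> : (fun w => ev (shap_word kap w) y) = (fun w => ev (fun u => shap_word kap u w) y).
  apply: functional_extensionality => w; apply: eq_ev => u; exact: shap_word_sym.
have [s [_ sP]] := If; rewrite sP -ev_exchange.
rewrite (@eq_ev _ _ _ (fun=> 0)) ?ev_const0 // => u.
by rewrite -sP; apply: in_serre_shap_word If.
Qed.

End Verma.

(** * Whittaker vectors and orthogonality *)

Section PositiveRootLattice.
Variable l : nat.
Implicit Types (b g : 'I_l -> nat).

Lemma subQ0 b : subQ b (@zeroQ l) = b.
Proof. by apply: functional_extensionality => i; rewrite /subQ subn0. Qed.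

Lemma subQQ b : subQ b b = @zeroQ l.
Proof. by apply: functional_extensionality => i; rewrite /subQ subnn. Qed.

Lemma addroot_subQ b g i : leQ (addroot g i) b ->
  addroot (subQ b (addroot g i)) i = subQ b g.
Proof.
move=> gb; apply: functional_extensionality => j; have := gb j.
by rewrite /addroot /subQ; lia.
Qed.

Lemma subQ_addroot b g i : leQ g b -> subQ (addroot b i) g = addroot (subQ b g) i.
Proof.
move=> gb; apply: functional_extensionality => j; have := gb j.
by rewrite /addroot /subQ; lia.
Qed.

Lemma subQ_addroot2 b g i : subQ (addroot b i) (addroot g i) = subQ b g.
Proof.
by apply: functional_extensionality => j; rewrite /addroot /subQ; lia.
Qed.

Lemma addQ_subQ b g : leQ g b -> addQ g (subQ b g) = b.
Proof.
move=> gb; apply: functional_extensionality => j; have := gb j.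
by rewrite /addQ /subQ; lia.
Qed.

Lemma leQ_subl b g : leQ (subQ b g) b.
Proof. by move=> j; rewrite leq_subr. Qed.

Lemma leQ_addroot g b i : leQ (addroot g i) b -> leQ g b.
Proof. by move=> gb j; apply: leq_trans (gb j); rewrite leq_addr. Qed.

Lemma leQ_trans g' g b : leQ g g' -> leQ g' b -> leQ g b.
Proof. by move=> gg' gb j; apply: leq_trans (gg' j) (gb j). Qed.

Definition lebQ g b := [forall i, (g i <= b i)%N].

Lemma lebQP g b : reflect (leQ g b) (lebQ g b).
Proof. exact: forallP. Qed.

Lemma rootw_subQ (A : 'M[int]_l) b g i :
  leQ g b -> rootw A b i = rootw A g i + rootw A (subQ b g) i.
Proof. by move=> gb; rewrite -rootwD addQ_subQ. Qed.

End PositiveRootLattice.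

Section Whittaker.
Variables (l : nat) (A : 'M[int]_l) (d : 'I_l -> nat) (K : fieldType).
Variables (N : nat) (tt : K).
Hypothesis tt_neq0 : tt != 0.
Hypothesis tt_order : forall n, (0 < n)%N -> tt ^+ n != 1.
Hypothesis N_gt0 : (0 < N)%N.
Hypothesis d_gt0 : forall i, (0 < d i)%N.
Hypothesis A_diag : forall i, A i i = 2.
Hypothesis A_le0 : forall i j, i != j -> A i j <= 0.
Hypothesis A_sym : forall i j, (d i)%:Z * A i j = (d j)%:Z * A j i.
Local Notation word := (seq 'I_l).
Local Notation v := (tt ^+ N).
Local Notation EW := (Eword A d N tt).
Local Notation inI := (in_serre A d N tt).
Local Notation shap := (shap_word A d N tt).
Implicit Types (phi : word -> K) (kap : 'I_l -> int) (b g B : 'I_l -> nat).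
Implicit Types (k kb : 'I_l -> ('I_l -> nat) -> K) (th : ('I_l -> nat) -> lc l K).

Lemma isWtP (x : lc l K) g phi psi :
    isWt x g -> (forall w, wt w = g -> phi w = psi w) -> ev phi x = ev psi x.
Proof.
move=> xg e; apply: eq_ev_in xg _ => p /forallP pg; apply: e.
by apply: functional_extensionality => k; exact: (eqP (pg k)).
Qed.

Lemma ev_Elc phi i kap x :
  ev phi (Elc A d N tt i kap x) = ev (fun w => ev phi (EW i kap w)) x.
Proof.
by rewrite /Elc ev_flatten /ev; apply: eq_bigr => p _; rewrite -/(ev _ _) ev_scale.
Qed.

(** The scalar by which K_{nu_i} acts on a weight component is moved into the eigenvalue [k i g],
    which therefore depends on the degree. In this form one notion covers both U_v and U_{1/v}. *)
Definition whittaker k kap b th : Prop :=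
  [/\ inI (fun phi => ev phi (th (@zeroQ l)) - phi [::]),
      (forall g, leQ g b -> isWt (th g) g) &
      (forall i g, leQ (addroot g i) b ->
         inI (fun phi => ev (fun w => ev phi (EW i kap w)) (th (addroot g i)) -
                         k i g * ev phi (th g)))].

Lemma whittaker_le k kap b b' th : leQ b' b ->
  whittaker k kap b th -> whittaker k kap b' th.
Proof.
move=> b'b [th0 thW thE]; split=> // [g gb|i g gb].
  by apply: thW; apply: leQ_trans gb b'b.
by apply: thE; apply: leQ_trans gb b'b.
Qed.

Definition whit_unique k kap b : Prop :=
  forall th th', whittaker k kap b th -> whittaker k kap b th' ->
  forall g, leQ g b -> inI (fun phi => ev phi (th g) - ev phi (th' g)).

Fixpoint chi k (w : word) : K :=
  if w is j :: w' then k j (wt w') * chi k w' else 1.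

(** Each letter j of w applies E_j, which produces an eigenvalue and lowers the degree of the
    Whittaker vector by alpha_j, down to degree 0. *)
Lemma shap_word_whittaker k kap b th w : whittaker k kap b th -> leQ (wt w) b ->
  ev (shap kap w) (th (wt w)) = chi k w.
Proof.
move=> [th0 thW thE]; elim: w => [_|j w IH].
  have := in_serre_shap_word tt_neq0 tt_order N_gt0 d_gt0 A_diag A_le0 A_sym kap [::] th0.
  by move/eqP; rewrite subr_eq0 => /eqP ->.
rewrite wt_cons => wb.
have := in_serre_shap_word tt_neq0 tt_order N_gt0 d_gt0 A_diag A_le0 A_sym kap w (thE j _ wb).
by move/eqP; rewrite subr_eq0 => /eqP /= ->; rewrite IH //; apply: leQ_addroot wb.
Qed.

Lemma shapovalov_whittaker k kap b th g x :
    whittaker k kap b th -> leQ g b -> isWt x g ->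
  shapovalov A d N tt kap x (th g) = ev (chi k) x.
Proof.
move=> thP gb xg; apply: isWtP xg _ => w wg.
by rewrite -(shap_word_whittaker thP) wg.
Qed.

(** Both sides are the Shapovalov product of [th g] and [thb g], evaluated from either side. *)
Lemma whittaker_pairing k kb kap b th thb g :
    whittaker k kap b th -> whittaker kb kap b thb -> leQ g b ->
  ev (chi kb) (th g) = ev (chi k) (thb g).
Proof.
move=> thP thbP gb; have [_ thW _] := thP; have [_ thbW _] := thbP.
rewrite -(shapovalov_whittaker thbP gb (thW g gb)) shapovalov_sym.
by rewrite (shapovalov_whittaker thP gb (thbW g gb)).
Qed.

Lemma ev_chi_whittaker0 k kb kap b th thb :
    whittaker k kap b th -> whittaker kb kap b thb ->
  ev (chi kb) (th (@zeroQ l)) = 1.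
Proof.
move=> thP thbP; have [th0 thW _] := thP.
have zb : leQ (@zeroQ l) b by [].
rewrite -(shapovalov_whittaker thbP zb (thW _ zb)) /shapovalov.
have := in_serre_shapovalov tt_neq0 tt_order N_gt0 d_gt0 A_diag A_le0 A_sym kap (thb (@zeroQ l)) th0.
move/eqP; rewrite subr_eq0 => /eqP ->.
exact: (shap_word_whittaker (w := [::]) thbP zb).
Qed.

Lemma in_serre_ev f (G : word -> word -> K) (s : lc l K) :
  inI f -> f (fun z => ev (G z) s) = ev (fun w => f (G^~ w)) s.
Proof.
move=> [t [_ tP]]; rewrite tP ev_exchange.
by apply: eq_ev => w; rewrite tP.
Qed.

Lemma in_serre_mulr_lc f s :
  inI f -> inI (fun phi => f (fun z => ev (fun w => phi (z ++ w)) s)).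
Proof.
move=> If; apply: (@eq_in_serre _ _ _ _ _ _ (fun phi => ev (fun w => f (fun z => phi (z ++ w))) s)).
  by move=> phi; rewrite (in_serre_ev (fun z w => phi (z ++ w))).
apply: (@in_serre_lc _ _ _ _ _ _ (fun w phi => f (fun z => phi (z ++ w))) _ predT).
  exact: all_predT.
by move=> p _; apply: (in_serre_mul [::] p.2 If).
Qed.

Lemma in_serre_mull_lc (G : word -> word) f s :
  inI f -> inI (fun phi => ev (fun u => f (fun z => phi (G u ++ z))) s).
Proof.
move=> If.
apply: (@in_serre_lc _ _ _ _ _ _ (fun w phi => f (fun z => phi (G w ++ z))) _ predT).
  exact: all_predT.
move=> p _; apply: (@eq_in_serre _ _ _ _ _ _ (fun phi => f (fun z => phi (G p.2 ++ z ++ [::])))).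
  move=> phi; congr (f _); apply: functional_extensionality => z.
  by rewrite cats0.
exact: (in_serre_mul (G p.2) [::] If).
Qed.

Definition mulc (x y : lc l K) : lc l K :=
  flatten [seq [seq (p.1 * p'.1, p.2 ++ p'.2) | p' <- y] | p <- x].

Lemma ev_mulc phi x y :
  ev phi (mulc x y) = ev (fun u => ev (fun w => phi (u ++ w)) y) x.
Proof.
rewrite /mulc ev_flatten; apply: eq_bigr => p _.
rewrite /ev big_map mulr_sumr; apply: eq_bigr => p' _ /=.
by rewrite mulrA.
Qed.

Lemma isWt_cat (x y : lc l K) g : isWt (x ++ y) g = isWt x g && isWt y g.
Proof. by rewrite /isWt all_cat. Qed.

Lemma isWt_scale (a : K) x g : isWt x g -> isWt (scale a x) g.
Proof. by rewrite /isWt all_map. Qed.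

Lemma isWt_flatten (T : Type) (r : seq T) (F : T -> lc l K) g :
  isWt (flatten [seq F i | i <- r]) g = all (fun i => isWt (F i) g) r.
Proof. by elim: r => //= i r IH; rewrite isWt_cat IH. Qed.

Lemma isWt_mulc (x y : lc l K) g g' :
  isWt x g -> isWt y g' -> isWt (mulc x y) (addQ g g').
Proof.
move=> xg yg; rewrite isWt_flatten.
apply: sub_all xg => p /forallP pg; rewrite /isWt all_map.
apply: sub_all yg => p' /forallP pg' /=; apply/forallP => k.
by rewrite count_cat /addQ (eqP (pg k)) (eqP (pg' k)).
Qed.

(* A singular vector s of weight kap - B would generate an image of the Verma
   module of highest weight kap - B, whose Whittaker vector could be added to
   the one of highest weight kap. *)
Lemma singular_vector_in_serre k kap b B th th' s :
    whit_unique k kap b -> leQ B b -> (exists i, B i != 0%N) ->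
    whittaker k kap b th ->
    whittaker (fun i g => k i (addQ g B)) (fun i => kap i - rootw A B i) (subQ b B) th' ->
    isWt s B -> (forall i, inI (fun phi => ev (fun w => ev phi (EW i kap w)) s)) ->
  inI (fun phi => ev phi s).
Proof.
move=> uniq Bb [i0 B0] thP th'P sB sE.
have [th0 thW thE] := thP; have [th'0 th'W th'E] := th'P.
(* The perturbed Whittaker vector theta + theta' s. The shift of the eigenvalues of [th'] by B makes
   those of theta' s agree with those of theta. *)
pose th2 g := th g ++ (if lebQ B g then mulc (th' (subQ g B)) s else [::]).
have B_n0 : lebQ B (@zeroQ l) = false.
  by apply/negbTE/forallPn; exists i0; rewrite -ltnNge lt0n.
have addQK g : leQ B g -> addQ (subQ g B) B = g.
  move=> Bg; apply: functional_extensionality => j; have := Bg j.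
  by rewrite /addQ /subQ; lia.
have sub_le g : leQ g b -> leQ (subQ g B) (subQ b B).
  by move=> gb j; have := gb j; rewrite /subQ; lia.
(* On x s the operator E_i acts on x as in the Verma module of highest weight kap - B, up to terms
   containing E_i s, which lie in the ideal. *)
have Emul i phi x : ev (fun w => ev phi (EW i kap w)) (mulc x s) =
    ev (fun u => ev (fun z => ev (fun w => phi (z ++ w)) s)
                    (EW i (fun i => kap i - rootw A B i) u)) x +
    ev (fun u => ev (fun w => ev (fun z => phi (u ++ z)) (EW i kap w)) s) x.
  rewrite ev_mulc -ev_funD; apply: eq_ev => u.
  rewrite ev_exchange -ev_funD; apply: isWtP sB _ => w wB.
  by rewrite (@ev_Eword_cat _ _ _ _ _ _ _ _ _ (fun i => kap i - rootw A B i)) ?wB.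
have th2P : whittaker k kap b th2.
  split=> [|g gb|i g gb].
  - by rewrite /th2 B_n0 cats0.
  - rewrite /th2 isWt_cat thW //=; case: ifP => // /lebQP Bg.
    by have := isWt_mulc (th'W _ (sub_le g gb)) sB; rewrite addQK.
  have gb' := leQ_addroot gb.
  pose f phi := ev (fun w => ev phi (EW i kap w)) (th (addroot g i)) - k i g * ev phi (th g).
  have If : inI f by apply: thE.
  rewrite /th2; have [/lebQP Bgi|Bgi] := boolP (lebQ B (addroot g i)); last first.
    have -> : lebQ B g = false.
      by apply: contraNF Bgi => /lebQP Bg; apply/lebQP => j; rewrite (leq_trans (Bg j)) ?leq_addr.
    by rewrite !cats0.
  have I2 : inI (fun phi =>
      ev (fun u => ev (fun w => ev (fun z => phi (u ++ z)) (EW i kap w)) s)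
         (th' (subQ (addroot g i) B))).
    exact: (in_serre_mull_lc id _ (sE i)).
  case: ifP => [/lebQP Bg|/negbT Bg].
    have e : subQ (addroot g i) B = addroot (subQ g B) i by rewrite subQ_addroot.
    have gb2 : leQ (addroot (subQ g B) i) (subQ b B) by rewrite -e; apply: sub_le.
    have I1 := in_serre_mulr_lc s (th'E i _ gb2).
    apply: eq_in_serre (in_serreD (in_serreD If I1) I2) => phi.
    rewrite /f !ev_cat Emul ev_mulc addQK // e.
    by ring.
  (* B is below g + alpha_i but not below g, so the two agree at i: the letter i does not occur in
     degree g + alpha_i - B, and E_i kills that component of theta'. *)
  have gBi : (subQ (addroot g i) B) i = 0%N.
    case/forallPn: Bg => j; rewrite -ltnNge => Bj; have := Bgi j.
    rewrite /subQ /addroot eqxx; case: eqP => [ji|_]; first by rewrite ji in Bj *; lia.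
    by lia.
  apply: eq_in_serre (in_serreD If I2) => phi.
  rewrite /f !ev_cat ev_nil addr0 Emul.
  suff -> : ev (fun u => ev (fun z => ev (fun w => phi (z ++ w)) s)
      (EW i (fun i => kap i - rootw A B i) u)) (th' (subQ (addroot g i) B)) = 0 by ring.
  transitivity (ev (fun=> 0 : K) (th' (subQ (addroot g i) B))); last exact: ev_const0.
  apply: isWtP (th'W _ (sub_le _ gb)) _ => w wE.
  rewrite ev_Eword_notin // -has_pred1 has_count -leqNgt leqn0; apply/eqP.
  by move: gBi; rewrite -wE.
(* In degree B the two Whittaker vectors differ by theta'_0 s, which is s modulo the ideal. *)
have := uniq _ _ th2P thP B Bb.
have BB : lebQ B B by apply/forallP.
move=> I3; have I4 := in_serre_mulr_lc s th'0.
apply: eq_in_serre (in_serreB I3 I4) => phi.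
rewrite /th2 BB subQQ ev_cat ev_mulc.
by set X := ev _ (th' _); set Y := ev _ (th _); rewrite /=; ring.
Qed.

(** * The singular vector built from two Whittaker vectors *)

Section Orthogonality.
Variables (S : nat).
Local Notation D := {ffun 'I_l -> 'I_S.+1}.
Definition deg (a : D) : 'I_l -> nat := fun i => a i.

Lemma sum_shift (V : nmodType) (F : ('I_l -> nat) -> V) i B : (forall j, (B j <= S)%N) ->
  \sum_(a : D | lebQ (deg a) B && (0 < a i)%N) F (deg a) =
  \sum_(a : D | lebQ (addroot (deg a) i) B) F (addroot (deg a) i).
Proof.
move=> BS; pose up (a : D) : D := [ffun j => inord (a j + (j == i))].
pose down (a : D) : D := [ffun j => inord (a j - (j == i))].
have upE a : lebQ (addroot (deg a) i) B -> deg (up a) = addroot (deg a) i.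
  move=> /lebQP aB; apply: functional_extensionality => j.
  by rewrite /deg ffunE inordK // ltnS (leq_trans (aB j)).
rewrite (reindex_onto up down) => [|a /andP[_ ai]] /=; last first.
  apply/ffunP => j; apply/val_inj; rewrite !ffunE /= inordK.
    rewrite inordK.
      by case: eqP => [->|_]; rewrite ?subn0 ?addn0 ?subnK.
    exact: leq_ltn_trans (leq_subr _ _) (ltn_ord _).
  rewrite inordK; last exact: leq_ltn_trans (leq_subr _ _) (ltn_ord _).
  by case: eqP => [->|_]; rewrite ?subn0 ?addn0 ?subnK.
have cond a : lebQ (deg (up a)) B && (0 < up a i)%N && (down (up a) == a) =
              lebQ (addroot (deg a) i) B.
  apply/idP/idP => [/andP[/andP[/lebQP aB ai] /eqP e]|aB].
    suff <- : deg (up a) = addroot (deg a) i by apply/lebQP.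
    apply: functional_extensionality => j; rewrite -[in RHS]e /addroot /deg [in RHS]ffunE.
    rewrite inordK; last exact: leq_ltn_trans (leq_subr _ _) (ltn_ord _).
    by case: eqP => [->|_]; rewrite ?subn0 ?addn0 ?subnK.
  have e := upE _ aB; rewrite e aB /=; apply/andP; split.
    have -> : up a i = addroot (deg a) i i :> nat by rewrite -e.
    by rewrite /addroot eqxx addn1.
  apply/eqP/ffunP => j; apply/val_inj; rewrite ffunE /=.
  have -> : up a j = addroot (deg a) i j :> nat by rewrite -e.
  by rewrite /addroot addnK /deg inord_val.
apply: eq_big => a; first exact: cond.
by rewrite cond => /upE ->.
Qed.

Variable n : 'I_l -> 'I_l -> int.

(** In the application [n i j] is (nu_i, alpha_j), so this is (nu_i, g), and [nform2] extends it
    linearly in the first argument. *)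
Definition nform i g : int := \sum_j n i j * (g j)%:Z.
Definition nform2 g g' : int := \sum_i (g i)%:Z * nform i g'.
Local Notation nf := nform.
Local Notation nf2 := nform2.

Lemma nf_addroot i g j : nf i (addroot g j) = nf i g + n i j.
Proof.
rewrite /nform /addroot; under eq_bigr do rewrite PoszD mulrDr.
rewrite big_split /=; congr (_ + _); rewrite (bigD1 j) //= eqxx mulr1 big1 ?addr0 //.
by move=> k /negbTE ->; rewrite mulr0.
Qed.

Lemma nf_addQ i g g' : nf i (addQ g g') = nf i g + nf i g'.
Proof. by rewrite /nform -big_split; apply: eq_bigr => j _; rewrite PoszD mulrDr. Qed.

Lemma nf0 i : nf i (@zeroQ l) = 0.
Proof. by rewrite /nform big1 // => j _; rewrite mulr0. Qed.

Lemma nf2_addrootl g j g' : nf2 (addroot g j) g' = nf2 g g' + nf j g'.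
Proof.
rewrite /nform2 /addroot; under eq_bigr do rewrite PoszD mulrDl.
rewrite big_split /=; congr (_ + _); rewrite (bigD1 j) //= eqxx mul1r big1 ?addr0 //.
by move=> k /negbTE ->; rewrite mul0r.
Qed.

Lemma nf2_addrootr g g' j :
  nf2 g (addroot g' j) = nf2 g g' + \sum_i (g i)%:Z * n i j.
Proof.
by rewrite /nform2 -big_split; apply: eq_bigr => i _; rewrite nf_addroot mulrDr.
Qed.

Lemma nf2_0l g : nf2 (@zeroQ l) g = 0.
Proof. by rewrite /nform2 big1 // => j _; rewrite mul0r. Qed.

Lemma nf2_0r g : nf2 g (@zeroQ l) = 0.
Proof. by rewrite /nform2 big1 // => j _; rewrite nf0 mulr0. Qed.

(** Eigenvalues of the Whittaker vectors of U_v; [eigenN] is the version for U_{1/v}. The power of v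
    undoes the action of K_{nu_i}. *)
Definition eigen (C : 'I_l -> K) i g := C i * v ^ (nf i g).
Definition eigenN (C : 'I_l -> K) i g := C i * v ^ (- nf i g).

Lemma chi_cat (C : 'I_l -> K) u w :
  chi (eigenN C) (u ++ w) = chi (eigenN C) u * chi (eigenN C) w * v ^ (- nf2 (wt u) (wt w)).
Proof.
elim: u => [|j u IH] /=; first by rewrite nf2_0l oppr0 expr0z mulr1 mul1r.
rewrite IH wt_cons nf2_addrootl wt_cat /eigenN nf_addQ !opprD !vXD //.
by ring.
Qed.

Lemma chi_neq0 (k : 'I_l -> ('I_l -> nat) -> K) w :
  (forall i g, k i g != 0) -> chi k w != 0.
Proof.
move=> k0; elim: w => [|j w IH] /=; first exact: oner_neq0.
by rewrite mulf_neq0.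
Qed.

Lemma eigenN_neq0 (C : 'I_l -> K) : (forall i, C i != 0) -> forall i g, eigenN C i g != 0.
Proof. by move=> C0 i g; rewrite mulf_neq0 // vX_neq0. Qed.

Variables (C Cb C' Cb' : 'I_l -> K).
Hypothesis Cb_neq0 : forall i, Cb i != 0.
Hypothesis C'_neq0 : forall i, C' i != 0.
Hypothesis CC' : forall i, C i * Cb i = C' i * Cb' i.

(** On a word w the character of [eigen] has as exponent the sum of n(w_p, w_q) over positions p <
    q, and that of [eigenN] on the reversed word has minus the sum of n(w_q, w_p). The difference
    runs over all ordered pairs of distinct positions, so it depends on the weight alone. *)
Definition rev_ratio g : K :=
  (\prod_i (Cb i / C' i) ^+ g i) * v ^ (\sum_i (g i)%:Z * n i i - nf2 g g).

Lemma rev_ratio_addroot g j : rev_ratio (addroot g j) =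
  rev_ratio g * (Cb j / C' j) * v ^ (- (\sum_i (g i)%:Z * n i j) - nf j g).
Proof.
rewrite /rev_ratio.
have -> : \prod_i (Cb i / C' i) ^+ addroot g j i = (\prod_i (Cb i / C' i) ^+ g i) * (Cb j / C' j).
  under eq_bigr do rewrite exprD.
  rewrite big_split /=; congr (_ * _); rewrite (bigD1 j) //= eqxx expr1 big1 ?mulr1 //.
  by move=> i /negbTE ->; rewrite expr0.
have -> : \sum_i (addroot g j i)%:Z * n i i = \sum_i (g i)%:Z * n i i + n j j.
  under eq_bigr do rewrite PoszD mulrDl.
  rewrite big_split /=; congr (_ + _); rewrite (bigD1 j) //= eqxx mul1r big1 ?addr0 //.
  by move=> i /negbTE ->; rewrite mul0r.
rewrite nf2_addrootl nf2_addrootr nf_addroot.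
set s1 := \sum_i _; set s2 := \sum_i _.
have -> : s1 + n j j - (nf2 g g + s2 + (nf j g + n j j)) =
          (s1 - nf2 g g) + (- s2 - nf j g) by ring.
by rewrite vXD //; ring.
Qed.

Lemma rev_ratio_neq0 g : rev_ratio g != 0.
Proof.
rewrite mulf_neq0 ?vX_neq0 //; apply/prodf_neq0 => i _.
by rewrite expf_neq0 // mulf_neq0 ?invr_neq0.
Qed.

Lemma chi_rev u : chi (eigenN Cb) (rev u) = chi (eigen C') u * rev_ratio (wt u).
Proof.
elim: u => [|j u IH] /=.
  rewrite /rev_ratio nf2_0l big1 => [|i _]; last by rewrite expr0.
  by rewrite big1 ?subr0 ?expr0z ?mulr1 // => i _; rewrite mul0r.
rewrite rev_cons -cats1 chi_cat IH /= wt_rev wt_cons nf2_addrootr wt_nil nf2_0r add0r.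
rewrite wt_cons rev_ratio_addroot /eigenN /eigen nf0 oppr0 expr0z !mulr1 !vXD //.
have e : v ^ nf j (wt u) * v ^ (- nf j (wt u)) = 1 by rewrite -vXD // addrN expr0z.
transitivity (chi (eigen C') u * rev_ratio (wt u) * Cb j * v ^ (- \sum_i (wt u i)%:Z * n i j) *
  (v ^ nf j (wt u) * v ^ (- nf j (wt u)))); first by rewrite e mulr1.
move: (v ^ nf _ _) (v ^ - _) (v ^ - _) => a b c; field.
exact: C'_neq0.
Qed.

(** Inverse of the twist that [chi_cat] and [chi_rev] produce on rev(u) w, for u of weight g and w
    of weight B - g. *)
Definition revcoef B g : K := (rev_ratio g * v ^ (- nf2 g (subQ B g)))^-1.

(** Matching condition in E_i [sing_vec]: lowering theta in the term of index g gives the same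
    vectors as lowering thetabar' in the term of index g + alpha_i. Here [CC'] enters. *)
Lemma revcoef_step B g i : leQ (addroot g i) B ->
  revcoef B g * eigen C i (subQ B (addroot g i)) =
  revcoef B (addroot g i) * eigenN Cb' i g.
Proof.
move=> gB; rewrite /revcoef rev_ratio_addroot -(addroot_subQ gB) nf2_addrootl nf2_addrootr.
set X := subQ B _; set s := \sum_i _.
have rn0 := rev_ratio_neq0 g.
have -> : - (nf2 g X + nf i X) = - (nf2 g X + s) + (s - nf i X) by ring.
rewrite /eigen /eigenN -/s !vXD //.
have e1 : v ^ (- nf i X) = (v ^ nf i X)^-1 by rewrite -invr_expz.
have e2 : v ^ (- s) = (v ^ s)^-1 by rewrite -invr_expz.
have e3 : v ^ (- nf i g) = (v ^ nf i g)^-1 by rewrite -invr_expz.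
rewrite e1 e2 e3.
have := vX_neq0 N tt_neq0 (nf i X); have := vX_neq0 N tt_neq0 (nf i g).
have := vX_neq0 N tt_neq0 s; have := vX_neq0 N tt_neq0 (- (nf2 g X + s)).
move: (v ^ _) (v ^ _) (v ^ _) (v ^ _) => a b c e a0 b0 c0 e0.
have -> : C i = C' i * Cb' i / Cb i by rewrite -CC' mulfK.
field.
by rewrite ?C'_neq0 ?Cb_neq0 ?rn0 ?a0 ?b0 ?c0 ?e0.
Qed.

Variables (kap kap' : 'I_l -> int) (b B : 'I_l -> nat).
Variables (th thb thb' : ('I_l -> nat) -> lc l K).
Hypothesis BS : forall j, (B j <= S)%N.
Hypothesis Bb : leQ B b.
Hypothesis B_neq0 : exists i, B i != 0%N.
Hypothesis kapE : forall i, kap' i = rootw A B i - kap i - 2.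
Hypothesis thP : whittaker (eigen C) kap b th.
Hypothesis thbP : whittaker (eigenN Cb) kap b thb.
Hypothesis thb'P : whittaker (eigenN Cb') kap' B thb'.

Definition rev_pairing phi (x y : lc l K) : K := ev (fun u => ev (fun w => phi (rev u ++ w)) y) x.

Definition sing_vec : lc l K :=
  flatten [seq scale (revcoef B (deg a))
    (mulc [seq (p.1, rev p.2) | p <- thb' (deg a)] (th (subQ B (deg a))))
    | a <- enum [pred a : D | lebQ (deg a) B]].

Lemma ev_sing_vec phi : ev phi sing_vec =
  \sum_(a : D | lebQ (deg a) B) revcoef B (deg a) * rev_pairing phi (thb' (deg a)) (th (subQ B (deg a))).
Proof.
rewrite /sing_vec ev_flatten big_enum /=; apply: eq_bigr => a _.
by rewrite ev_scale ev_mulc (ev_map (fun u => ev (fun w => phi (u ++ w)) _) (@rev _)).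
Qed.

Lemma isWt_sing_vec : isWt sing_vec B.
Proof.
have [_ thW _] := thP; have [_ thb'W _] := thb'P.
rewrite isWt_flatten; apply/allP => a; rewrite mem_enum => /lebQP aB.
apply: isWt_scale; rewrite -(addQ_subQ aB); apply: isWt_mulc; last first.
  by rewrite addQ_subQ //; apply: thW; apply: leQ_trans Bb; apply: leQ_subl.
have := thb'W _ aB; rewrite /isWt all_map; apply: sub_all => p /forallP pa /=.
by apply/forallP => k; rewrite count_rev.
Qed.

Lemma ev_Eword_sing_vec i phi : ev (fun w => ev phi (EW i kap w)) sing_vec =
  \sum_(a : D | lebQ (deg a) B) revcoef B (deg a) *
    (ev (fun u => ev (fun w => ev (fun z => phi (rev u ++ z)) (EW i kap w)) (th (subQ B (deg a)))) (thb' (deg a))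
   - ev (fun u => ev (fun z => ev (fun w => phi (rev z ++ w)) (th (subQ B (deg a)))) (EW i kap' u)) (thb' (deg a))).
Proof.
have [_ thW _] := thP; have [_ thb'W _] := thb'P.
rewrite ev_sing_vec; apply: eq_bigr => a /lebQP aB; congr (_ * _).
rewrite -ev_funN -ev_funD; apply: isWtP (thb'W _ aB) _ => u ua.
have BaB : leQ (subQ B (deg a)) b by apply: leQ_trans Bb; apply: leQ_subl.
rewrite ev_exchange -ev_funN -ev_funD; apply: isWtP (thW _ BaB) _ => w wa.
rewrite (@ev_Eword_cat _ _ _ _ _ _ _ _ _ (fun t => kap t - rootw A (wt w) t)) // addrC.
(* The factor w lowers the highest weight seen by rev(u) to kap - (B - a), whose partner under
   reversal of a word of weight a is [kap'], by [kapE]. *)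
congr (_ + _); apply: (ev_Eword_rev d tt_neq0 N_gt0 A_diag (fun x => phi (x ++ w))).
by rewrite kapE (rootw_subQ A i aB) ua wa; ring.
Qed.

(** E_i lowers theta on the right ([T1], congruent to [R1]) and, with the opposite sign, thetabar'
    on the left ([T2], congruent to [R2]). The weighted sums of [R1] and [R2] are equal. *)
Lemma in_serre_Eword_sing_vec i : inI (fun phi => ev (fun w => ev phi (EW i kap w)) sing_vec).
Proof.
have [_ thW thE] := thP; have [_ thb'W thb'E] := thb'P.
pose T1 g phi := ev (fun u => ev (fun w => ev (fun z => phi (rev u ++ z)) (EW i kap w)) (th (subQ B g))) (thb' g).
pose T2 g phi := ev (fun u => ev (fun z => ev (fun w => phi (rev z ++ w)) (th (subQ B g))) (EW i kap' u)) (thb' g).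
pose pr g : 'I_l -> nat := fun j => (g j - (j == i))%N.
have prK g : pr (addroot g i) = g.
  by apply: functional_extensionality => j; rewrite /pr /addroot addnK.
have prK' g : (0 < g i)%N -> addroot (pr g) i = g.
  move=> gi; apply: functional_extensionality => j; rewrite /pr /addroot.
  by case: eqP => [->|_]; rewrite ?subnK ?subn0 ?addn0.
pose R1 g phi := if lebQ (addroot g i) B then
  eigen C i (subQ B (addroot g i)) * rev_pairing phi (thb' g) (th (subQ B (addroot g i))) else 0.
pose R2 g phi := if (0 < g i)%N then
  eigenN Cb' i (pr g) * rev_pairing phi (thb' (pr g)) (th (subQ B g)) else 0.
have I1 g : leQ g B -> inI (fun phi => T1 g phi - R1 g phi).
  move=> gB; rewrite /T1 /R1; case: (boolP (lebQ (addroot g i) B)) => [/lebQP giB|giB].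
    have gib : leQ (addroot (subQ B (addroot g i)) i) b.
      by rewrite addroot_subQ //; apply: leQ_trans Bb; apply: leQ_subl.
    have := in_serre_mull_lc (@rev _) (thb' g) (thE i _ gib).
    apply: eq_in_serre => phi; by rewrite addroot_subQ // -ev_funZ -ev_funN -ev_funD.
  (* If g + alpha_i is not below B, no word of weight B - g contains the letter i. *)
  apply: eq_in_serre (in_serre0 _ _ _ _) => phi; rewrite subr0 -(ev_const0 (thb' g)).
  apply: eq_ev => u; rewrite -(ev_const0 (th (subQ B g))).
  apply: isWtP (thW _ (leQ_trans (@leQ_subl _ B g) Bb)) _ => w wE.
  rewrite ev_Eword_notin // -has_pred1 has_count -leqNgt leqn0; apply/eqP.
  rewrite -[count _ _]/(wt w i) wE /subQ; apply/eqP; rewrite subn_eq0.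
  case/forallPn: giB => j; rewrite /addroot -ltnNge; case: eqP => [-> |_].
    by rewrite addn1.
  by rewrite addn0 ltnNge (gB j).
have I2 g : leQ g B -> inI (fun phi => T2 g phi - R2 g phi).
  move=> gB; rewrite /T2 /R2; case: (boolP (0 < g i)%N) => gi.
    have gib : leQ (addroot (pr g) i) B by rewrite prK'.
    have := in_serre_mulr_lc (th (subQ B g)) (in_serre_rev (thb'E i _ gib)).
    by apply: eq_in_serre => phi; rewrite prK'.
  apply: eq_in_serre (in_serre0 _ _ _ _) => phi; rewrite subr0 -(ev_const0 (thb' g)).
  apply: isWtP (thb'W _ gB) _ => u uE.
  rewrite ev_Eword_notin // -has_pred1 has_count -leqNgt leqn0; apply/eqP.
  by apply/eqP; rewrite -[count _ _]/(wt u i) uE -leqn0 leqNgt.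
have J1 := @in_serre_sum _ A d _ N tt D (index_enum _) (fun a => lebQ (deg a) B)
  (fun a phi => revcoef B (deg a) * (T1 (deg a) phi - R1 (deg a) phi))
  (fun a aB => in_serreZ _ (I1 _ (elimT (lebQP _ _) aB))).
have J2 := @in_serre_sum _ A d _ N tt D (index_enum _) (fun a => lebQ (deg a) B)
  (fun a phi => revcoef B (deg a) * (T2 (deg a) phi - R2 (deg a) phi))
  (fun a aB => in_serreZ _ (I2 _ (elimT (lebQP _ _) aB))).
apply: eq_in_serre (in_serreB J1 J2) => phi; rewrite ev_Eword_sing_vec.
rewrite -/T1 -/T2.
(* The index of the second sum is shifted by alpha_i with [sum_shift]; then [revcoef_step] compares
   term by term. *)
have R12 : \sum_(a : D | lebQ (deg a) B) revcoef B (deg a) * R1 (deg a) phi =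
           \sum_(a : D | lebQ (deg a) B) revcoef B (deg a) * R2 (deg a) phi.
  transitivity (\sum_(a : D | lebQ (addroot (deg a) i) B)
    revcoef B (deg a) * eigen C i (subQ B (addroot (deg a) i)) * rev_pairing phi (thb' (deg a)) (th (subQ B (addroot (deg a) i)))).
    rewrite [LHS](bigID (fun a : D => lebQ (addroot (deg a) i) B)) /= [X in _ + X]big1 ?addr0.
      apply: eq_big => a; last by case/andP=> _ ai; rewrite /R1 ai mulrA.
      rewrite andb_idl // => /lebQP ai; apply/lebQP; exact: leQ_addroot ai.
    by move=> a /andP[_ /negbTE ai]; rewrite /R1 ai mulr0.
  rewrite [RHS](bigID (fun a : D => (0 < a i)%N)) /= [X in _ = _ + X]big1 ?addr0; last first.
    by move=> a /andP[_ /negbTE ai]; rewrite /R2 /deg ai mulr0.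
  pose F g := revcoef B g * (eigenN Cb' i (pr g) * rev_pairing phi (thb' (pr g)) (th (subQ B g))).
  transitivity (\sum_(a : D | lebQ (deg a) B && (0 < a i)%N) F (deg a)).
    rewrite sum_shift //; apply: eq_bigr => a /lebQP aB.
    by rewrite /F prK mulrA -revcoef_step // mulrA.
  by apply: eq_bigr => a /andP[_ ai]; rewrite /R2 /deg ai.
transitivity (\sum_(a : D | lebQ (deg a) B) revcoef B (deg a) * (T1 (deg a) phi - R1 (deg a) phi) -
   \sum_(a : D | lebQ (deg a) B) revcoef B (deg a) * (T2 (deg a) phi - R2 (deg a) phi)) => //.
rewrite -sumrB -[RHS]subr0.
rewrite -[X in _ = _ - X](subrr (\sum_(a : D | lebQ (deg a) B) revcoef B (deg a) * R2 (deg a) phi)).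
rewrite -[in X in _ = _ - (X - _)]R12 -!sumrB; apply: eq_bigr => a _.
rewrite -/(T1 (deg a) phi) -/(T2 (deg a) phi) /=.
by move: (T1 _ _) (T2 _ _) (R1 _ _) (R2 _ _) => t1 t2 r1 r2; ring.
Qed.

(** [sing_vec] lies in the Serre ideal, so its product with [thb B] vanishes. That product is a
    value of the character, and [revcoef] cancels its twist, leaving products of two characters. *)
Lemma whittaker_orthogonality :
    whit_unique (eigen C) kap b ->
    (exists th2, whittaker (fun i g => eigen C i (addQ g B))
                  (fun i => kap i - rootw A B i) (subQ b B) th2) ->
  \sum_(a : D | lebQ (deg a) B)
     ev (chi (eigen C')) (thb' (deg a)) * ev (chi (eigenN Cb)) (th (subQ B (deg a))) = 0.
Proof.
move=> uniq [th2 th2P].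
have [_ thW _] := thP; have [_ thb'W _] := thb'P.
have I := singular_vector_in_serre uniq Bb B_neq0 thP th2P isWt_sing_vec in_serre_Eword_sing_vec.
have := in_serre_shapovalov tt_neq0 tt_order N_gt0 d_gt0 A_diag A_le0 A_sym kap (thb B) I.
rewrite -/(shapovalov A d N tt kap sing_vec (thb B)) (shapovalov_whittaker thbP Bb isWt_sing_vec) ev_sing_vec => e0; rewrite -[RHS]e0.
apply: eq_bigr => a /lebQP aB; rewrite /rev_pairing mulrC -ev_funZ -ev_funZ.
apply: isWtP (thb'W _ aB) _ => u ua; rewrite mulrC -ev_funZ -ev_funZ.
have BaB : leQ (subQ B (deg a)) b by apply: leQ_trans Bb; apply: leQ_subl.
apply: isWtP (thW _ BaB) _ => w wa; rewrite chi_cat chi_rev wt_rev ua wa /revcoef.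
have := rev_ratio_neq0 (deg a); have := vX_neq0 N tt_neq0 (- nf2 (deg a) (subQ B (deg a))).
by move: (v ^ _) (rev_ratio _) (chi _ _) (chi _ _) => x y z t x0 y0; field; rewrite x0 y0.
Qed.

End Orthogonality.

End Whittaker.

(** * The Casimir recursion *)

Section Recursion.
Variables (l : nat) (A : 'M[int]_l) (d : 'I_l -> nat) (K : fieldType).
Variables (N : nat) (tt : K).
Hypothesis tt_neq0 : tt != 0.
Hypothesis tt_order : forall n, (0 < n)%N -> tt ^+ n != 1.
Hypothesis N_gt0 : (0 < N)%N.
Hypothesis d_gt0 : forall i, (0 < d i)%N.
Hypothesis A_diag : forall i, A i i = 2.
Hypothesis A_le0 : forall i j, i != j -> A i j <= 0.
Hypothesis A_sym : forall i j, (d i)%:Z * A i j = (d j)%:Z * A j i.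
Local Notation word := (seq 'I_l).
Local Notation q := (qint d N tt).
Local Notation v := (tt ^+ N).
Local Notation vi := (vpow d N tt).
Local Notation EW := (Eword A d N tt).
Local Notation inI := (in_serre A d N tt).
Local Notation whittaker := (whittaker A d N tt).
Local Notation whit_unique := (whit_unique A d N tt).
Implicit Types (phi : word -> K) (kap : 'I_l -> int) (b g : 'I_l -> nat).

Lemma formPQ_addroot kap g i :
  formPQ d kap (addroot g i) = formPQ d kap g + kap i * (d i)%:Z.
Proof.
rewrite /formPQ /addroot; under eq_bigr do rewrite PoszD mulrDr mulrDl.
rewrite big_split /=; congr (_ + _); rewrite (bigD1 i) //= eqxx mulr1 big1 ?addr0 //.
by move=> k /negbTE ->; rewrite mulr0 mul0r.
Qed.

Lemma formQQ_addrootl g i a :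
  formQQ A d (addroot g i) a = formQQ A d g a + (d i)%:Z * rootw A a i.
Proof.
rewrite /formQQ /addroot -(@exchange_big _ _ _ _ _ _ _ xpredT xpredT).
rewrite -[X in _ = X + _](@exchange_big _ _ _ _ _ _ _ xpredT xpredT) /=.
rewrite /rootw mulr_sumr -big_split; apply: eq_bigr => j _ /=.
under eq_bigr do rewrite PoszD !mulrDl.
rewrite big_split /=; congr (_ + _); rewrite (bigD1 i) //= eqxx mul1r big1 ?addr0.
  by ring.
by move=> k /negbTE ->; rewrite !mul0r.
Qed.

Lemma formQQ_sym g a : formQQ A d g a = formQQ A d a g.
Proof.
rewrite /formQQ exchange_big; apply: eq_bigr => i _; apply: eq_bigr => j _.
by rewrite A_sym [(g j)%:Z * _]mulrC.
Qed.

Lemma formQQ_addrootr g a i :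
  formQQ A d g (addroot a i) = formQQ A d g a + (d i)%:Z * rootw A g i.
Proof. by rewrite formQQ_sym formQQ_addrootl formQQ_sym. Qed.

Lemma formQQ_addroot2 g i : formQQ A d (addroot g i) (addroot g i) =
  formQQ A d g g + 2 * ((d i)%:Z * rootw A g i + (d i)%:Z).
Proof.
by rewrite formQQ_addrootl formQQ_addrootr rootw_addroot A_diag; ring.
Qed.

(** The monomial with one block F_j^(g j) for each node of s. Partial lists s occur when the
    monomial is split at a node. *)
Definition coxeter_word (s g : _) : word := flatten [seq nseq (g j) j | j <- s].

Lemma wt_coxeter_word (s : seq 'I_l) g j : uniq s -> wt (coxeter_word s g) j = if j \in s then g j else 0%N.
Proof.
elim: s => [|i s IH] //= /andP[is_ us].
rewrite /coxeter_word /= -/(coxeter_word s g) wt_cat /addQ IH // wt_nseq inE.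
by case: eqP => [->|_]; rewrite ?mul1n ?mul0n ?add0n // (negbTE is_) addn0.
Qed.

Definition half_norm g : int := (formQQ A d g g %/ 2)%Z.

(** The root lattice is even since (alpha_i, alpha_i) = 2 d_i. The induction adds one letter at a
    time to a word of weight g. *)
Lemma formQQ_even g : formQQ A d g g = 2 * half_norm g.
Proof.
suff H w : exists h, formQQ A d (wt w) (wt w) = 2 * h.
  have -> : g = wt (coxeter_word (enum 'I_l) g).
    by apply: functional_extensionality => j; rewrite wt_coxeter_word ?enum_uniq // mem_enum.
  by have [h e] := H (coxeter_word (enum 'I_l) g); rewrite /half_norm e mulKz.
elim: w => [|j w [h IH]].
  exists 0; rewrite mulr0 /formQQ big1 // => i _; rewrite big1 // => j _.
  by rewrite mul0r.
by rewrite wt_cons formQQ_addroot2 IH -mulrDr; eexists.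
Qed.

Lemma half_norm_addroot g i : half_norm (addroot g i) = half_norm g + (d i)%:Z * rootw A g i + (d i)%:Z.
Proof. by have := formQQ_addroot2 g i; rewrite !formQQ_even; lia. Qed.

Lemma half_norm0 : half_norm (@zeroQ l) = 0.
Proof.
rewrite /half_norm /formQQ big1 ?div0z // => i _; rewrite big1 // => j _.
by rewrite mul0r.
Qed.

Lemma qpoch_addroot g i :
  qpoch d N tt (addroot g i) = qpoch d N tt g * (1 - vi i (2 * (g i).+1%:Z)).
Proof.
have E j k : vq N tt (2 * (d j)%:R * k%:R) = vi j (2 * k%:Z).
  have -> : 2 * (d j)%:R * k%:R = (2 * (d j)%:Z * k%:Z)%:~R :> rat.
    by rewrite !intrM !mulrz_nat.
  by rewrite vq_int /vpow mulrCA mulrA.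
rewrite /qpoch (bigD1 i) //= [in RHS](bigD1 i) //= [in RHS]mulrAC.
congr (_ * _); last first.
  by apply: eq_bigr => j ji; rewrite /addroot (negbTE ji) addn0.
have -> : addroot g i i = (g i).+1 by rewrite /addroot eqxx addn1.
by rewrite big_ord_recr /= E.
Qed.

Lemma qpoch0 : qpoch d N tt (@zeroQ l) = 1.
Proof. by rewrite /qpoch big1 // => i _; rewrite big_ord0. Qed.

Lemma qpoch_neq0 g : qpoch d N tt g != 0.
Proof.
apply/prodf_neq0 => i _; apply/prodf_neq0 => k _.
have -> : 2 * (d i)%:R * k.+1%:R = (2 * (d i)%:Z * k.+1%:Z)%:~R :> rat.
  by rewrite !intrM !mulrz_nat.
rewrite vq_int subr_eq0 eq_sym.
have -> : 2 * (d i)%:Z * k.+1%:Z = (2 * d i * k.+1)%N%:Z :> int by [].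
by rewrite vX_neq1 // !muln_gt0 d_gt0.
Qed.

(** * Coefficients of the Casimir vector and their relation at a node *)

Variables (n : 'I_l -> 'I_l -> int) (es : seq 'I_l).
Hypothesis es_uniq : uniq es.
Hypothesis es_all : forall i, i \in es.
Hypothesis es_order : forall s1 i s2 j, es = s1 ++ i :: s2 -> j \in s2 ->
  n i j - n j i = - ((d i)%:Z * A i j).

Variables (C Cb : 'I_l -> K).
Hypothesis Cb_neq0 : forall i, Cb i != 0.
Hypothesis CCb : forall i, C i * Cb i * ((1 - vi i 2) * (1 - vi i (- 2))) = 1.
Variables (kap : 'I_l -> int) (b : 'I_l -> nat) (S : nat).
Variables (th thb : ('I_l -> nat) -> lc l K).
Hypothesis bS : forall j, (b j <= S)%N.
Hypothesis thP : whittaker (eigen N tt n C) kap b th.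
Hypothesis thbP : whittaker (eigenN N tt n Cb) kap b thb.
Local Notation D := {ffun 'I_l -> 'I_S.+1}.
Local Notation kb := (eigenN N tt n Cb).
Local Notation nf := (nform n).
Local Notation nf2 := (nform2 n).

Lemma wt_coxeter_word_es g : wt (coxeter_word es g) = g.
Proof. by apply: functional_extensionality => j; rewrite wt_coxeter_word // es_all. Qed.

Lemma coxeter_word_notin (s : seq 'I_l) g i : i \notin s -> coxeter_word s (addroot g i) = coxeter_word s g.
Proof.
move=> i_s; rewrite /coxeter_word; congr flatten; apply/eq_in_map => j js.
rewrite /addroot; case: eqP => [ji|_]; last by rewrite addn0.
by rewrite -ji js in i_s.
Qed.

(** This is |kap + rho - a|^2 - |kap + rho|^2, the difference of the Casimir eigenvalues at the
    highest weights kap - a and kap. *)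
Definition casimir_log a : int := formQQ A d a a - 2 * formPQ d (fun i => kap i + 1) a.

Definition casimir_exp g a : int :=
  casimir_log a - (formPQ d kap g - formQQ A d a g) + half_norm g.

(** The power v^(nf2 g a) and the character in the denominator cancel the value of the character on
    the monomial in front of theta_a, so that only [casimir_exp] and [qpoch] survive in
    [whittaker_recursion]. *)
Definition casimir_coef g a : K :=
  v ^ (casimir_exp g a + nf2 g a) / (qpoch d N tt g * chi kb (coxeter_word es g)).

(** The sl_2 factor of [ev_Eword_nseq] when E_i meets the block F_i^(g i), with the blocks of s2 and
    a vector of degree a on its right. *)
Definition coxeter_coef s2 i g a : K :=
  q i (g i)%:Z * q i (kap i - rootw A a i - rootw A (wt (coxeter_word s2 g)) i - (g i)%:Z + 1).

(** Rational identity behind [casimir_coef_step], where H, M and V become v_i^(h-m), v_i^(m+1) and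
    v_i, and X, W, Y the powers of v with exponents x, w0, y. The relation between c and cb is used
    to eliminate c. *)
Lemma casimir_coef_step_field (X W H M V Y c cb p ch : K) :
    H != 0 -> M != 0 -> V != 0 -> Y != 0 -> cb != 0 -> p != 0 -> ch != 0 ->
    1 - M ^+ 2 != 0 -> 1 - V ^+ 2 != 0 ->
    c * cb * ((1 - V ^+ 2) * (1 - (V ^+ 2)^-1)) = 1 ->
  c * (X * W / H / (p * ch)) +
  X * W * M / Y / (p * (1 - M ^+ 2) * (ch * cb / Y)) *
    ((M - M^-1) / (V - V^-1) * ((H - H^-1) / (V - V^-1))) =
  c * (W * H) * (X / (p * ch)).
Proof.
move=> H0 M0 V0 Y0 cb0 p0 ch0 M1 V1 e.
have V1' : V ^+ 2 - 1 != 0 by rewrite -oppr_eq0 opprB.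
have -> : c = (cb * ((1 - V ^+ 2) * (1 - (V ^+ 2)^-1)))^-1.
  have nz : cb * ((1 - V ^+ 2) * (1 - (V ^+ 2)^-1)) != 0.
    by apply: contra_eq_neq e => /= z0; rewrite -mulrA z0 mulr0 eq_sym oner_eq0.
  by apply: (mulIf nz); rewrite mulVf // mulrA.
by field; rewrite ?H0 ?M0 ?V0 ?Y0 ?cb0 ?p0 ?ch0 ?M1 ?V1 ?V1'.
Qed.

Section Node.
Variables (s1 s2 : seq 'I_l) (i : 'I_l).
Hypothesis esE : es = s1 ++ i :: s2.

Lemma s1_uniq : uniq s1.
Proof. by move: es_uniq; rewrite esE cat_uniq => /andP[]. Qed.
Lemma s2_uniq : uniq s2.
Proof. by move: es_uniq; rewrite esE cat_uniq /= => /and3P[_ _ /andP[]]. Qed.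
Lemma i_s1 : i \notin s1.
Proof. by move: es_uniq; rewrite esE cat_uniq /= negb_or => /and3P[_ /andP[]]. Qed.
Lemma i_s2 : i \notin s2.
Proof. by move: es_uniq; rewrite esE cat_uniq /= => /and3P[_ _ /andP[]]. Qed.

Lemma coxeter_word_split g : coxeter_word es g = coxeter_word s1 g ++ nseq (g i) i ++ coxeter_word s2 g.
Proof. by rewrite esE /coxeter_word map_cat flatten_cat. Qed.

Lemma coxeter_word_addroot g :
  coxeter_word es (addroot g i) = coxeter_word s1 g ++ i :: (nseq (g i) i ++ coxeter_word s2 g).
Proof.
rewrite coxeter_word_split !coxeter_word_notin ?i_s1 ?i_s2 //.
by rewrite /addroot eqxx addn1.
Qed.

Lemma rootw_split g : rootw A g i =
  rootw A (wt (coxeter_word s1 g)) i + 2 * (g i)%:Z + rootw A (wt (coxeter_word s2 g)) i.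
Proof.
by rewrite -{1}(wt_coxeter_word_es g) coxeter_word_split !rootw_cat rootw_nseq A_diag mulrC addrA.
Qed.

(** By [es_order] the skew part of n is the invariant form up to a sign: plus for the nodes before
    i, minus for those after i, as in [nf_post]. *)
Lemma nf_pre g : nf i (wt (coxeter_word s1 g)) - \sum_j (wt (coxeter_word s1 g) j)%:Z * n j i =
  (d i)%:Z * rootw A (wt (coxeter_word s1 g)) i.
Proof.
rewrite /rootw mulr_sumr -sumrB; apply: eq_bigr => j _.
rewrite wt_coxeter_word ?s1_uniq //; case: ifP => [js|_]; last by rewrite !mul0r !mulr0 subrr.
have /splitPr js' := js; move: esE; case: js' => p1 p2 e.
have := @es_order p1 j (p2 ++ i :: s2) i; rewrite e -catA /= mem_cat inE eqxx orbT.
move=> /(_ erefl isT) H; rewrite [n i j * _]mulrC -mulrBr mulrCA; congr (_ * _).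
by rewrite A_sym -[RHS]opprK -H opprB.
Qed.

Lemma nf_post g : \sum_j (wt (coxeter_word s2 g) j)%:Z * n j i - nf i (wt (coxeter_word s2 g)) =
  (d i)%:Z * rootw A (wt (coxeter_word s2 g)) i.
Proof.
rewrite /rootw mulr_sumr -sumrB; apply: eq_bigr => j _.
rewrite wt_coxeter_word ?s2_uniq //; case: ifP => [js|_]; last by rewrite !mul0r !mulr0 subrr.
have H := es_order esE js; rewrite [n i j * _]mulrC -mulrBr mulrCA; congr (_ * _).
by rewrite -[RHS]opprK -H opprB.
Qed.

Lemma nf_split g : nf i g =
  nf i (wt (coxeter_word s1 g)) + n i i * (g i)%:Z + nf i (wt (coxeter_word s2 g)).
Proof.
rewrite -{1}(wt_coxeter_word_es g) coxeter_word_split !wt_cat !nf_addQ addrA; congr (_ + _ + _).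
rewrite /nform (bigD1 i) //= wt_nseq eqxx mul1n big1 ?addr0 // => j /negbTE ji.
by rewrite wt_nseq ji mulr0.
Qed.

Lemma nfT_split g : \sum_j (g j)%:Z * n j i =
  \sum_j (wt (coxeter_word s1 g) j)%:Z * n j i + n i i * (g i)%:Z +
  \sum_j (wt (coxeter_word s2 g) j)%:Z * n j i.
Proof.
transitivity (\sum_j (wt (coxeter_word es g) j)%:Z * n j i); first by rewrite wt_coxeter_word_es.
rewrite coxeter_word_split; under eq_bigr do rewrite !wt_cat /addQ !PoszD !mulrDl.
rewrite !big_split /= addrA; congr (_ + _ + _).
rewrite (bigD1 i) //= wt_nseq eqxx mul1n mulrC big1 ?addr0 // => j /negbTE ji.
by rewrite wt_nseq ji mul0r.
Qed.

Lemma chi_coxeter_word_addroot g : chi kb (coxeter_word es (addroot g i)) =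
  chi kb (coxeter_word es g) * Cb i *
  v ^ (- (n i i * (g i)%:Z + nf i (wt (coxeter_word s2 g)) + \sum_j (wt (coxeter_word s1 g) j)%:Z * n j i)).
Proof.
rewrite coxeter_word_addroot coxeter_word_split; set X := nseq _ _ ++ _.
have XE : nf i (wt X) = n i i * (g i)%:Z + nf i (wt (coxeter_word s2 g)).
  rewrite wt_cat nf_addQ; congr (_ + _).
  rewrite /nform (bigD1 i) //= wt_nseq eqxx mul1n big1 ?addr0 // => j /negbTE ji.
  by rewrite wt_nseq ji mulr0.
clearbody X; rewrite !chi_cat // wt_cons nf2_addrootr /= {2}/eigenN XE.
set x := nf2 _ _; set y := \sum_j _; set z := _ + _.
have -> : - (x + y) = - x + - y by ring.
have -> : - (z + y) = - z + - y by ring.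
by rewrite !vXD //; ring.
Qed.

Lemma vi2_neq1 (m : nat) : 1 - vi i (2 * m.+1%:Z) != 0.
Proof. by rewrite subr_eq0 eq_sym (@vi_neq1 _ d K N tt tt_order N_gt0 d_gt0 i (2 * m.+1)). Qed.

Lemma casimir_coef_step g a :
  casimir_coef g (addroot a i) * eigen N tt n C i a + casimir_coef (addroot g i) a * coxeter_coef s2 i (addroot g i) a =
  eigen N tt n C i (addQ a g) * casimir_coef g a.
Proof.
rewrite /coxeter_coef coxeter_word_notin ?i_s2 // [addroot g i i]/addroot eqxx addn1.
set R := rootw A (wt (coxeter_word s2 g)) i; set m := g i; set L := rootw A (wt (coxeter_word s1 g)) i.
pose h := kap i - rootw A a i - R.
have -> : kap i - rootw A a i - R - m.+1%:Z + 1 = h - m%:Z by rewrite /h; lia.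
pose x := casimir_exp g a + nf2 g a.
pose e1 := 2 * (d i)%:Z * rootw A a i - 2 * (d i)%:Z * kap i + (d i)%:Z * rootw A g i +
           \sum_j (g j)%:Z * n j i.
pose c := \sum_j (wt (coxeter_word s1 g) j)%:Z * n j i.
pose y := n i i * m%:Z + nf i (wt (coxeter_word s2 g)) + c.
pose e2 := (d i)%:Z * rootw A a i - (d i)%:Z * kap i + nf i a + (d i)%:Z * rootw A g i + (d i)%:Z.
have E1 : casimir_exp g (addroot a i) + nf2 g (addroot a i) = x + e1.
  rewrite /casimir_exp /casimir_log formQQ_addroot2 formPQ_addroot formQQ_addrootl nf2_addrootr /x /casimir_exp /casimir_log /e1.
  by ring.
have E2 : casimir_exp (addroot g i) a + nf2 (addroot g i) a = x + e2.
  rewrite /casimir_exp formPQ_addroot formQQ_addrootr nf2_addrootl half_norm_addroot /x /casimir_exp /e2.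
  by ring.
rewrite /casimir_coef E1 E2 qpoch_addroot chi_coxeter_word_addroot -/y.
(* The exponents of the first term and of the right side lie symmetrically around w0, at distance
   d_i (h - m). [F1] uses the nodes after i, [F2] those before i. *)
have F1 : e1 + nf i a = e2 + y + (d i)%:Z * (- (m%:Z + 1)) + (d i)%:Z * (m%:Z - h).
  have := nf_post g; have := rootw_split g; have := nfT_split g.
  rewrite -/R -/L -/m -/c => T1 T2 T3.
  by rewrite /e1 /e2 /y /h T1 T2; move: T3; set z := \sum_j _ => T3; nia.
have F2 : e2 + y + (d i)%:Z * (- (m%:Z + 1)) + (d i)%:Z * (h - m%:Z) = nf i (addQ a g).
  have := nf_pre g; have := rootw_split g; have := nf_split g.
  rewrite -/R -/L -/m -/c nf_addQ => T1 T2 T3.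
  by rewrite /e2 /y /h T1 T2; nia.
have m1 := vi2_neq1 m.
have viE z : vi i z = v ^ ((d i)%:Z * z) by [].
have ch0 : chi kb (coxeter_word es g) != 0 by apply: chi_neq0 => j g'; apply: eigenN_neq0.
have qp0 := qpoch_neq0 g.
set w0 := e2 + y + (d i)%:Z * (- (m%:Z + 1)) in F1 F2.
have F3 : x + e2 = x + w0 + (d i)%:Z * (m%:Z + 1) - y by rewrite /w0; ring.
have F4 : x + e1 + nf i a = x + w0 - (d i)%:Z * (h - m%:Z).
  rewrite -(addrA x e1 (nf i a)) F1.
  by clearbody x w0 h; ring.
have T1 : v ^ (x + e1) * v ^ nf i a = v ^ x * v ^ w0 / vi i (h - m%:Z).
  by rewrite viE invr_expz -!vXD // F4.
have T2 : v ^ (x + e2) = v ^ x * v ^ w0 * vi i (m%:Z + 1) / v ^ y.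
  by rewrite viE invr_expz -!vXD // F3.
have T3 : v ^ nf i (addQ a g) = v ^ w0 * vi i (h - m%:Z).
  by rewrite viE -!vXD // F2.
have v2 z : vi i (2 * z) = vi i z ^+ 2.
  by rewrite !viE expr2 -vXD //; congr (v ^ _); ring.
have T4 : C i * Cb i * ((1 - vi i 1 ^+ 2) * (1 - (vi i 1 ^+ 2)^-1)) = 1.
  by rewrite -v2 -viN CCb.
rewrite /eigen T2 T3 -/x !qintE // -invr_expz.
rewrite -/m (_ : m.+1%:Z = m%:Z + 1) ?v2 in m1 *; last by lia.
rewrite [_ * (C i * _)]mulrCA -[v ^ (x + e1) / _ * _]mulrAC T1.
clear T1 T2 T3 F1 F2 F3 F4 E1 E2.
clearbody x e1 y e2 w0 h m R.
apply: casimir_coef_step_field => //; rewrite ?vi_neq0 ?vX_neq0 //.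
by rewrite -v2 (vi2_neq1 0).
Qed.

End Node.

Definition casimir_vec (B : 'I_l -> nat) : lc l K :=
  flatten [seq scale (casimir_coef (subQ B (deg a)) (deg a))
     [seq (p.1, coxeter_word es (subQ B (deg a)) ++ p.2) | p <- th (deg a)]
     | a <- enum [pred a : D | lebQ (deg a) B]].

Definition coxeter_pairing phi g a : K := ev (fun w => phi (coxeter_word es g ++ w)) (th a).

Lemma ev_casimir_vec phi B : ev phi (casimir_vec B) =
  \sum_(a : D | lebQ (deg a) B) casimir_coef (subQ B (deg a)) (deg a) * coxeter_pairing phi (subQ B (deg a)) (deg a).
Proof.
rewrite /casimir_vec ev_flatten big_enum /=; apply: eq_bigr => a _.
by rewrite ev_scale (ev_map phi (cat (coxeter_word es (subQ B (deg a))))).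
Qed.

Lemma isWt_casimir_vec B : leQ B b -> isWt (casimir_vec B) B.
Proof.
move=> Bb; have [_ thW _] := thP.
rewrite isWt_flatten; apply/allP => a; rewrite mem_enum => /lebQP aB.
apply: isWt_scale; have := thW _ (leQ_trans aB Bb); rewrite /isWt all_map.
apply: sub_all => p /forallP pa /=; apply/forallP => k.
rewrite count_cat -/(wt (coxeter_word es (subQ B (deg a))) k) wt_coxeter_word_es (eqP (pa k)) /subQ.
by rewrite subnK // aB.
Qed.

(** The blocks of s1 and s2 do not contain the letter i, so E_i acts only on the block of i and on
    w. *)
Lemma ev_Eword_coxeter_word phi s1 i s2 g w : es = s1 ++ i :: s2 ->
  ev phi (EW i kap (coxeter_word es g ++ w)) =
  ev (fun z => phi (coxeter_word es g ++ z)) (EW i kap w) +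
  coxeter_coef s2 i g (wt w) * phi (coxeter_word es (fun j => (g j - (j == i))%N) ++ w).
Proof.
move=> esE; pose g' : 'I_l -> nat := fun j => (g j - (j == i))%N; rewrite -/g'.
have cwE s : i \notin s -> coxeter_word s g' = coxeter_word s g.
  move=> i_s; rewrite /coxeter_word; congr flatten; apply/eq_in_map => j js; congr nseq.
  rewrite /g'; case: eqP => [ji|_]; last by rewrite subn0.
  by rewrite -ji js in i_s.
rewrite (@ev_Eword_cat _ _ _ _ _ _ _ _ _ (fun t => kap t - rootw A (wt w) t)) // addrC.
congr (_ + _); rewrite !(coxeter_word_split esE) (cwE _ (i_s1 esE)) (cwE _ (i_s2 esE)).
have g'i : g' i = (g i).-1 by rewrite /g' eqxx subn1.
rewrite (@ev_Eword_cat _ _ _ _ _ _ _ _ _ (fun t => kap t - rootw A (wt w) t -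
  rootw A (wt (nseq (g i) i ++ coxeter_word s2 g)) t)) // ev_Eword_notin; last first.
  by apply/negP => /flattenP[s /mapP[j js ->]]; rewrite mem_nseq => /andP[_ /eqP ij]; move: (i_s1 esE); rewrite ij js.
rewrite add0r (@ev_Eword_cat _ _ _ _ _ _ _ _ _ (fun t => kap t - rootw A (wt w) t -
  rootw A (wt (coxeter_word s2 g)) t)) // [X in _ + X]ev_Eword_notin ?addr0; last first.
  by apply/negP => /flattenP[s /mapP[j js ->]]; rewrite mem_nseq => /andP[_ /eqP ij]; move: (i_s2 esE); rewrite ij js.
by rewrite ev_Eword_nseq // g'i /coxeter_coef -!catA.
Qed.

Lemma casimir_coef00 : casimir_coef (@zeroQ l) (@zeroQ l) = 1.
Proof.
have cw0 (s : seq 'I_l) : coxeter_word s (@zeroQ l) = [::] by elim: s.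
have PQ0 k : formPQ d k (@zeroQ l) = 0.
  by rewrite /formPQ big1 // => j _; rewrite mulr0 mul0r.
have QQ0 : formQQ A d (@zeroQ l) (@zeroQ l) = 0 by rewrite formQQ_even half_norm0 mulr0.
rewrite /casimir_coef /casimir_exp /casimir_log cw0 qpoch0 half_norm0 nf2_0l QQ0 !PQ0 /= mulr1 divr1.
by rewrite mulr0 !subrr ?addr0 expr0z.
Qed.

Lemma lebQ_zero a : lebQ a (@zeroQ l) -> a = @zeroQ l.
Proof.
move=> /lebQP a0; apply: functional_extensionality => j.
by have := a0 j; rewrite leqn0 => /eqP.
Qed.

Lemma sum_zeroQ (F : ('I_l -> nat) -> K) :
  \sum_(a : D | lebQ (deg a) (@zeroQ l)) F (deg a) = F (@zeroQ l).
Proof.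
pose z : D := [ffun=> ord0].
have zE : deg z = @zeroQ l by apply: functional_extensionality => j; rewrite /deg ffunE.
rewrite (bigD1 z) /=; last by rewrite zE; apply/lebQP.
rewrite zE big1 ?addr0 // => a /andP[/lebQ_zero a0 /eqP []].
apply/ffunP => j; apply/val_inj; rewrite ffunE /=.
by rewrite -[nat_of_ord (a j)]/(deg a j) a0.
Qed.

(** In E_i applied to degree g + alpha_i, the terms where E_i lowers theta ([S1]) and those where it
    shortens the block of i ([S2]) are rewritten over the same monomials times theta_a with a below
    g; [casimir_coef_step] adds them up. *)
Lemma whittaker_casimir_vec : whittaker (eigen N tt n C) kap b casimir_vec.
Proof.
have [th0 thW thE] := thP; split; [|exact: isWt_casimir_vec|].
  apply: eq_in_serre th0 => phi; rewrite ev_casimir_vec.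
  rewrite (sum_zeroQ (fun a => casimir_coef (subQ (@zeroQ l) a) a * coxeter_pairing phi (subQ (@zeroQ l) a) a)).
  rewrite subQQ casimir_coef00 mul1r /coxeter_pairing; congr (_ - _); apply: eq_ev => w.
  by have -> : coxeter_word es (@zeroQ l) = [::] by elim: (es).
move=> i g gib; have gb := leQ_addroot gib.
have /splitPr esE := es_all i; set gi := addroot g i in gib *.
have [s1 [s2 {}esE]] : exists s1 s2, es = s1 ++ i :: s2.
  by case: esE => s1 s2; exists s1, s2.
pose pr a : 'I_l -> nat := fun j => (a j - (j == i))%N.
have prK a : pr (addroot a i) = a.
  by apply: functional_extensionality => j; rewrite /pr /addroot addnK.
have prK' a : (0 < a i)%N -> addroot (pr a) i = a.
  move=> ai; apply: functional_extensionality => j; rewrite /pr /addroot.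
  by case: eqP => [->|_]; rewrite ?subnK ?subn0 ?addn0.
pose T a phi := ev (fun w => ev (fun z => phi (coxeter_word es (subQ gi a) ++ z)) (EW i kap w)) (th a).
pose R a phi := if (0 < a i)%N then eigen N tt n C i (pr a) * coxeter_pairing phi (subQ gi a) (pr a) else 0.
have IT a : leQ a gi -> inI (fun phi => T a phi - R a phi).
  move=> agi; have ab := leQ_trans agi gib.
  rewrite /T /R; case: (boolP (0 < a i)%N) => ai.
    have aib : leQ (addroot (pr a) i) b by rewrite prK'.
    have := in_serre_mul (coxeter_word es (subQ gi a)) [::] (thE i _ aib).
    apply: eq_in_serre => phi; rewrite prK' //.
    have e : (fun x => phi (coxeter_word es (subQ gi a) ++ x ++ [::])) = (fun x => phi (coxeter_word es (subQ gi a) ++ x)).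
      by apply: functional_extensionality => x; rewrite cats0.
    by rewrite e.
  apply: eq_in_serre (in_serre0 _ _ _ _) => phi; rewrite subr0 -(ev_const0 (th a)).
  apply: isWtP (thW _ ab) _ => w wE.
  rewrite ev_Eword_notin // -has_pred1 has_count -leqNgt leqn0; apply/eqP.
  by apply/eqP; rewrite -[count _ _]/(wt w i) wE -leqn0 leqNgt.
have E phi : ev (fun w => ev phi (EW i kap w)) (casimir_vec gi) =
    \sum_(a : D | lebQ (deg a) gi) casimir_coef (subQ gi (deg a)) (deg a) * (T (deg a) phi +
      coxeter_coef s2 i (subQ gi (deg a)) (deg a) * coxeter_pairing phi (pr (subQ gi (deg a))) (deg a)).
  rewrite ev_casimir_vec; apply: eq_bigr => a /lebQP agi; congr (_ * _).
  rewrite /coxeter_pairing /T -ev_funZ -ev_funD; apply: isWtP (thW _ (leQ_trans agi gib)) _ => w wE.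
  by rewrite (ev_Eword_coxeter_word phi (subQ gi (deg a)) w esE) wE.
have J := @in_serre_sum _ A d _ N tt D (index_enum _) (fun a => lebQ (deg a) gi)
  (fun a phi => casimir_coef (subQ gi (deg a)) (deg a) * (T (deg a) phi - R (deg a) phi))
  (fun a agi => in_serreZ _ (IT _ (elimT (lebQP _ _) agi))).
apply: eq_in_serre J => phi; rewrite E.
have giS j : (gi j <= S)%N by apply: leq_trans (bS j); apply: gib.
have S1 : \sum_(a : D | lebQ (deg a) gi) casimir_coef (subQ gi (deg a)) (deg a) * R (deg a) phi =
    \sum_(a : D | lebQ (deg a) g) casimir_coef (subQ g (deg a)) (addroot (deg a) i) * eigen N tt n C i (deg a) *
       coxeter_pairing phi (subQ g (deg a)) (deg a).
  pose F a := casimir_coef (subQ gi a) a * (eigen N tt n C i (pr a) * coxeter_pairing phi (subQ gi a) (pr a)).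
  rewrite (bigID (fun a : D => (0 < a i)%N)) /= [X in _ + X]big1 ?addr0; last first.
    by move=> a /andP[_ /negbTE ai]; rewrite /R /deg ai mulr0.
  transitivity (\sum_(a : D | lebQ (deg a) gi && (0 < a i)%N) F (deg a)).
    by apply: eq_bigr => a /andP[_ ai]; rewrite /R /deg ai.
  rewrite sum_shift //; apply: eq_big => a.
    by apply: eq_forallb => j; rewrite /gi /addroot leq_add2r.
  by move=> _; rewrite /F prK /gi subQ_addroot2 mulrA.
have S2 : \sum_(a : D | lebQ (deg a) gi) casimir_coef (subQ gi (deg a)) (deg a) *
      (coxeter_coef s2 i (subQ gi (deg a)) (deg a) * coxeter_pairing phi (pr (subQ gi (deg a))) (deg a)) =
    \sum_(a : D | lebQ (deg a) g) casimir_coef (addroot (subQ g (deg a)) i) (deg a) *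
      coxeter_coef s2 i (addroot (subQ g (deg a)) i) (deg a) * coxeter_pairing phi (subQ g (deg a)) (deg a).
  rewrite (bigID (fun a : D => lebQ (deg a) g)) /= [X in _ + X]big1 ?addr0; last first.
    move=> a /andP[/lebQP agi /forallPn[j aj]].
    (* For a below g + alpha_i but not below g the block of i is empty, and its factor contains [0]
       = 0. *)
    have s0 : subQ gi (deg a) i = 0%N.
      have := agi j; rewrite /subQ /gi /addroot eqxx; move: aj; rewrite -ltnNge.
      by case: eqP => [->|_]; lia.
    by rewrite /coxeter_coef s0 qint0 // !mul0r mulr0.
  apply: eq_big => a.
    apply: andb_idl => /lebQP ag; apply/lebQP => j.
    by apply: leq_trans (ag j) _; rewrite leq_addr.
  by case/andP=> _ /lebQP ag; rewrite /gi subQ_addroot // prK mulrA.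
have S3 : eigen N tt n C i g * ev phi (casimir_vec g) =
    \sum_(a : D | lebQ (deg a) gi) casimir_coef (subQ gi (deg a)) (deg a) * R (deg a) phi +
    \sum_(a : D | lebQ (deg a) gi) casimir_coef (subQ gi (deg a)) (deg a) *
      (coxeter_coef s2 i (subQ gi (deg a)) (deg a) * coxeter_pairing phi (pr (subQ gi (deg a))) (deg a)).
  rewrite S1 S2 -big_split ev_casimir_vec mulr_sumr; apply: eq_bigr => a /lebQP ag /=.
  by rewrite -mulrDl (casimir_coef_step esE) addQ_subQ // mulrA.
rewrite S3 -big_split -sumrB; apply: eq_bigr => a _ /=.
by move: (T _ _) (R _ _) (coxeter_coef _ _ _ _ * _) => t r x; ring.
Qed.

(** By uniqueness [casimir_vec B] and [th B] agree modulo the ideal; pairing both with [thb B]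
    evaluates the character on them. *)
Lemma whittaker_recursion B : whit_unique (eigen N tt n C) kap b -> leQ B b ->
  ev (chi kb) (th B) =
  \sum_(a : D | lebQ (deg a) B)
     v ^ (casimir_exp (subQ B (deg a)) (deg a)) / qpoch d N tt (subQ B (deg a)) *
     ev (chi kb) (th (deg a)).
Proof.
move=> uniq Bb; have [_ thW _] := thP.
have I := uniq _ _ thP whittaker_casimir_vec B Bb.
have := in_serre_shapovalov tt_neq0 tt_order N_gt0 d_gt0 A_diag A_le0 A_sym kap (thb B) I.
have pairE := shapovalov_whittaker tt_neq0 tt_order N_gt0 d_gt0 A_diag A_le0 A_sym thbP Bb.
rewrite -!/(shapovalov A d N tt kap _ (thb B)) !pairE ?isWt_casimir_vec ?thW //.
move=> /eqP; rewrite subr_eq0 => /eqP ->; rewrite ev_casimir_vec.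
apply: eq_bigr => a /lebQP aB; rewrite /coxeter_pairing -!ev_funZ.
apply: isWtP (thW _ (leQ_trans aB Bb)) _ => w wE.
rewrite chi_cat // wE wt_coxeter_word_es /casimir_coef vXD //.
have e : v ^ nf2 (subQ B (deg a)) (deg a) * v ^ (- nf2 (subQ B (deg a)) (deg a)) = 1.
  by rewrite -vXD // addrN expr0z.
have ch0 : chi kb (coxeter_word es (subQ B (deg a))) != 0.
  by apply: chi_neq0 => j g'; apply: eigenN_neq0.
have qp0 := qpoch_neq0 (subQ B (deg a)).
move: (v ^ nf2 _ _) (v ^ (- nf2 _ _)) e => X Y e.
transitivity (v ^ casimir_exp (subQ B (deg a)) (deg a) / qpoch d N tt (subQ B (deg a)) * chi kb w * (X * Y)).
  move: (chi _ _) (chi _ _) (qpoch _ _ _ _) (v ^ _) ch0 qp0 => c1 c2 qq gx c0 q0.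
  by field; rewrite c0 q0.
by rewrite e mulr1.
Qed.

End Recursion.

(** * Weights and specialization at a power of v *)

Lemma sum_left_inverse (K : fieldType) (T : finType) (P : pred T) (F G : T -> T -> K) :
    (forall x y, P x -> P y -> \sum_(z | P z) F x z * G z y = (x == y)%:R) ->
  forall x y, P x -> P y -> \sum_(z | P z) G x z * F z y = (x == y)%:R.
Proof.
move=> FG x y Px Py; pose e (i : 'I_#|P|) : T := enum_val i.
have Pe i : P (e i) by have := enum_valP i.
pose MF := \matrix_(i, j) F (e i) (e j); pose MG := \matrix_(i, j) G (e i) (e j).
have H : MF *m MG = 1%:M.
  apply/matrixP => i j; rewrite !mxE.
  transitivity (\sum_(z in P) F (e i) z * G z (e j)); first by rewrite [RHS]big_enum_val; apply: eq_bigr => k _; rewrite !mxE.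
  rewrite FG //.
  by rewrite (inj_eq enum_val_inj).
have /matrixP H' := mulmx1C H.
have := H' (enum_rank_in Px x) (enum_rank_in Py y); rewrite !mxE => H2.
transitivity (\sum_(z in P) G x z * F z y) => //; rewrite big_enum_val.
transitivity ((enum_rank_in Px x == enum_rank_in Py y)%:R : K).
  by rewrite -H2; apply: eq_bigr => i _; rewrite !mxE /e !enum_rankK_in.
congr (nat_of_bool _)%:R; apply/eqP/eqP => [E|xy]; last first.
  by apply: enum_val_inj; rewrite !enum_rankK_in.
by have := congr1 enum_val E; rewrite !enum_rankK_in.
Qed.

Lemma one_sub_vi2_neq0 (l : nat) (d : 'I_l -> nat) (K : fieldType) (N : nat) (tt : K) i :
    (forall n, (0 < n)%N -> tt ^+ n != 1) -> (0 < N)%N -> (0 < d i)%N ->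
  1 - vpow d N tt i 2 != 0.
Proof.
move=> tt_order N0 d0; rewrite subr_eq0 eq_sym /vpow -PoszM -exprnP -exprM.
by rewrite tt_order // !muln_gt0 N0 d0.
Qed.

Section Translation.
Variables (l : nat) (A : 'M[int]_l) (d : 'I_l -> nat) (K : fieldType) (N : nat).
Hypothesis N_gt0 : (0 < N)%N.
Hypothesis d_gt0 : forall i, (0 < d i)%N.
Hypothesis A_diag : forall i, A i i = 2.
Hypothesis A_le0 : forall i j, i != j -> A i j <= 0.
Hypothesis A_sym : forall i j, (d i)%:Z * A i j = (d j)%:Z * A j i.
Hypothesis A_posdef : forall x : 'I_l -> rat, (exists i, x i != 0) ->
  0 < \sum_i \sum_j x i * x j * (d i)%:R * (A i j)%:~R.
Hypothesis N_int : forall i j, denq (N%:R * formPP A d (fundw i) (fundw j)) = 1.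
Variable nu : 'I_l -> 'I_l -> int.
Implicit Types (lam kap : 'I_l -> int) (b g : 'I_l -> nat) (th : ('I_l -> nat) -> lc l K).

Local Notation Aq := (map_mx (fun z : int => z%:~R : rat) A).
Definition nud i j : int := nu i j * (d j)%:Z.
Local Notation nf := (nform nud).

(** If x A = 0, the vector with coordinates x_j / d_j is isotropic for the positive definite
    form. *)
Lemma cartan_unit : Aq \in unitmx.
Proof.
rewrite unitmxE unitfE; apply/negP => /det0P [x x0 xA].
have [i xi] : exists i, x 0 i != 0.
  apply/existsP; apply: contraR x0 => /existsPn z; apply/eqP/rowP => i.
  by rewrite mxE; apply/eqP; have := z i; rewrite negbK.
have d0 j : (d j)%:R != 0 :> rat by rewrite pnatr_eq0 -lt0n.
have := @A_posdef (fun j => x 0 j / (d j)%:R) _; rewrite exchange_big /= big1 ?ltxx.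
  move=> H; suff: false by []; apply: H; exists i.
  by rewrite mulf_neq0 ?invr_neq0.
move=> j _; have := congr1 (fun M : 'rV_l => M 0 j) xA; rewrite !mxE => xAj.
transitivity (x 0 j / (d j)%:R * \sum_k x 0 k * Aq k j); last by rewrite xAj mulr0.
rewrite mulr_sumr; apply: eq_bigr => k _; rewrite mxE.
by field; rewrite !d0.
Qed.

(** Simple roots are the columns of A, so the inverse Cartan matrix in [formPP] cancels and leaves
    the integer (nu_i, g). *)
Lemma formPP_rootw kap lam g i : nu i = kap ->
  formPP A d kap (fun k => lam k - rootw A g k) =
  formPP A d kap lam - (nf i g)%:~R.
Proof.
move=> <-; rewrite /formPP /nform rmorph_sum -sumrB; apply: eq_bigr => j _ /=.
have inv k : \sum_t invmx Aq j t * Aq t k = (j == k)%:R.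
  have := congr1 (fun M : 'M_l => M j k) (mulVmx cartan_unit).
  by rewrite !mxE.
have -> : (nud i j * (g j)%:Z)%:~R = (nu i j)%:~R * (d j)%:R * \sum_t (rootw A g t)%:~R * invmx Aq j t :> rat.
  transitivity ((nu i j)%:~R * (d j)%:R * \sum_k (g k)%:R * \sum_t invmx Aq j t * Aq t k : rat).
    under [X in _ = _ * X]eq_bigr do rewrite inv.
    rewrite (bigD1 j) //= eqxx mulr1 big1 ?addr0 => [|k]; last first.
      by rewrite eq_sym => /negbTE ->; rewrite mulr0.
    by rewrite /nud !intrM -!pmulrn.
  congr (_ * _); under eq_bigr do rewrite mulr_sumr.
  rewrite exchange_big; apply: eq_bigr => t _; rewrite /rootw rmorph_sum mulr_suml.
  by apply: eq_bigr => k _; rewrite mxE rmorphM /= -pmulrn; ring.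
rewrite mulr_sumr -sumrB; apply: eq_bigr => t _.
by rewrite rmorphB; ring.
Qed.

Lemma formPP_int kap lam : exists m : int, formPP A d kap lam * N%:R = m%:~R.
Proof.
have fE i j : formPP A d (fundw i) (fundw j) = (d i)%:R * invmx Aq i j.
  rewrite /formPP (bigD1 i) //= (bigD1 j) //= /fundw !eqxx !mul1r.
  rewrite big1 ?addr0 => [|k /negbTE ->]; last by rewrite mulr0 !mul0r.
  rewrite big1 ?addr0 // => k /negbTE ki; rewrite big1 // => t _.
  by rewrite ki !mul0r.
have z i j : (d i)%:R * invmx Aq i j * N%:R = (numq (N%:R * formPP A d (fundw i) (fundw j)))%:~R.
  by rewrite -fE mulrC -[LHS]divq_num_den N_int divr1.
exists (\sum_i \sum_j kap i * lam j * numq (N%:R * formPP A d (fundw i) (fundw j))).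
rewrite /formPP mulr_suml rmorph_sum; apply: eq_bigr => i _.
rewrite mulr_suml rmorph_sum; apply: eq_bigr => j _.
by rewrite !rmorphM /= -z; ring.
Qed.

Lemma formPQ_rootw g a : formPQ d (rootw A g) a = formQQ A d g a.
Proof.
rewrite (formQQ_sym A_sym) /formPQ /formQQ; apply: eq_bigr => i _.
rewrite /rootw -mulrA mulr_suml; apply: eq_bigr => j _; ring.
Qed.

Lemma formPQ_sub kap lam g :
  formPQ d (fun k => kap k - lam k) g = formPQ d kap g - formPQ d lam g.
Proof. by rewrite /formPQ -sumrB; apply: eq_bigr => j _; ring. Qed.

Lemma formPQ_add kap lam g :
  formPQ d (fun k => kap k + lam k) g = formPQ d kap g + formPQ d lam g.
Proof. by rewrite /formPQ -big_split; apply: eq_bigr => j _ /=; ring. Qed.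

Lemma formPQ_addQ kap g a : formPQ d kap (addQ g a) = formPQ d kap g + formPQ d kap a.
Proof. by rewrite /formPQ -big_split; apply: eq_bigr => j _ /=; rewrite PoszD; ring. Qed.

Lemma formQQ_addQl g g' a : formQQ A d (addQ g g') a = formQQ A d g a + formQQ A d g' a.
Proof.
rewrite /formQQ -big_split; apply: eq_bigr => i _; rewrite -big_split /=.
by apply: eq_bigr => j _; rewrite PoszD; ring.
Qed.

Lemma formQQ_addQr g g' a : formQQ A d a (addQ g g') = formQQ A d a g + formQQ A d a g'.
Proof. by rewrite !(formQQ_sym A_sym a) formQQ_addQl. Qed.

Lemma half_norm_addQ g a : half_norm A d (addQ g a) = half_norm A d g + half_norm A d a + formQQ A d g a.
Proof.
have E x := formQQ_even A_diag A_sym x.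
have := E (addQ g a); rewrite formQQ_addQl !formQQ_addQr (E g) (E a) (formQQ_sym A_sym a g).
by move: (half_norm _ _ _) (half_norm _ _ _) (half_norm _ _ _) (formQQ _ _ _ _); clear => x y z t; lia.
Qed.

Section Specialization.
Variable tt : K.
Hypothesis tt_neq0 : tt != 0.
Hypothesis tt_order : forall n, (0 < n)%N -> tt ^+ n != 1.
Local Notation v := (tt ^+ N).
Local Notation vi := (vpow d N tt).

(** [vq] reads off the numerator of x N, hence the assumption that x N is an integer. *)
Lemma vq_subint (x : rat) (z : int) : (exists m : int, x * N%:R = m%:~R) ->
  vq N tt (x - z%:~R) = vq N tt x * v ^ (- z).
Proof.
move=> [m xm]; rewrite /vq mulrBl xm -[N%:R]mulrz_nat -intrM -rmorphB !numq_int natz.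
by rewrite expfzDr // exprnP exprz_exp; congr (_ * tt ^ _); ring.
Qed.

Lemma vq_2d i : vq N tt (2 * (d i)%:R) = vi i 2.
Proof.
have -> : 2 * (d i)%:R = ((d i)%:Z * 2)%:~R :> rat by rewrite intrM mulrz_nat mulrC.
by rewrite vq_int.
Qed.

Lemma vq_neq0 x : vq N tt x != 0.
Proof. by rewrite expfz_neq0. Qed.

(** The scalar c_i / (1 - v_i^2) divided by v^(nu_i, lam - alpha_i), by which K_{nu_i} acts in
    degree alpha_i; this is the eigenvalue at g = 0. *)
Definition whitC (c : 'I_l -> K) lam i : K :=
  c i / (1 - vi i 2) / vq N tt (formPP A d (nu i) lam) * v ^ nud i i.

Lemma whit_coef c lam i g :
  c i / (1 - vq N tt (2 * (d i)%:R)) =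
  vq N tt (formPP A d (nu i) (fun k => lam k - rootw A (addroot g i) k)) *
  eigen N tt nud (whitC c lam) i g.
Proof.
rewrite (@formPP_rootw _ _ _ i) // vq_subint ?nf_addroot; last exact: formPP_int.
rewrite vq_2d /eigen /whitC opprD !vXD //.
have := vq_neq0 (formPP A d (nu i) lam).
have e z : v ^ (- z) = (v ^ z)^-1 by rewrite -invr_expz.
have := vX_neq0 N tt_neq0 (nf i g); have := vX_neq0 N tt_neq0 (nud i i).
have := one_sub_vi2_neq0 tt_order N_gt0 (d_gt0 i); rewrite !e.
move: (v ^ _) (v ^ _) (vq _ _ _) (vi _ _) => x y z w w0 x0 y0 z0.
by field; rewrite w0 x0 y0 z0.
Qed.

(** The two conditions differ by the invertible scalar by which K_{nu_i} acts in degree g +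
    alpha_i. *)
Lemma WhitTrP c lam b th :
  WhitTr A d N tt c nu lam b th <->
  whittaker A d N tt (eigen N tt nud (whitC c lam)) lam b th.
Proof.
pose f i g phi := vq N tt (formPP A d (nu i) (fun k => lam k - rootw A (addroot g i) k)) *
   ev phi (Elc A d N tt i lam (th (addroot g i))) -
   c i / (1 - vq N tt (2 * (d i)%:R)) * ev phi (th g).
pose f' i g phi := ev (fun w => ev phi (Eword A d N tt i lam w)) (th (addroot g i)) -
   eigen N tt nud (whitC c lam) i g * ev phi (th g).
have ff i g phi : f i g phi =
    vq N tt (formPP A d (nu i) (fun k => lam k - rootw A (addroot g i) k)) * f' i g phi.
  by rewrite /f /f' (whit_coef c lam i g) ev_Elc; ring.
split=> -[th0 thW thE]; split=> //.
- move/veqP: th0; apply: eq_in_serre => phi; rewrite ev_seq1 mul1r //.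
- move=> i g gb; have /veqP I := thE i g gb.
  have := in_serreZ (vq N tt (formPP A d (nu i) (fun k => lam k - rootw A (addroot g i) k)))^-1 I.
  apply: eq_in_serre => phi; rewrite !ev_scale -/(f i g phi) ff mulKf //.
  exact: vq_neq0.
- by apply/veqP; apply: eq_in_serre th0 => phi; rewrite ev_seq1 mul1r.
move=> i g gb; apply/veqP.
have := in_serreZ (vq N tt (formPP A d (nu i) (fun k => lam k - rootw A (addroot g i) k))) (thE i g gb).
by apply: eq_in_serre => phi; rewrite !ev_scale -/(f i g phi) ff.
Qed.

End Specialization.

(** * The substitution v -> 1/v and the values of J *)

Section Inverse.
Variable tt : K.
Hypothesis tt_neq0 : tt != 0.
Hypothesis tt_order : forall n, (0 < n)%N -> tt ^+ n != 1.
Local Notation v := (tt ^+ N).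
Local Notation vi := (vpow d N tt).

Lemma invtt_order n : (0 < n)%N -> tt^-1 ^+ n != 1.
Proof. by move=> n0; rewrite exprVn invr_eq1 tt_order. Qed.

Lemma vq_inv x : vq N tt^-1 x = (vq N tt x)^-1.
Proof. by rewrite /vq exprz_inv invr_expz. Qed.

Lemma vX_inv (z : int) : (tt^-1 ^+ N) ^ z = v ^ (- z).
Proof. by rewrite exprVn exprz_inv. Qed.

Lemma vi_inv i z : vpow d N tt^-1 i z = vi i (- z).
Proof. by rewrite /vpow vX_inv mulrN. Qed.

(** This invariance is why the Verma modules of U_v and U_{1/v} share the formulas for raising
    operators and the Serre relations, so that the pairing becomes the Shapovalov form. *)
Lemma qint_inv i z : qint d N tt^-1 i z = qint d N tt i z.
Proof.
have i0 : tt^-1 != 0 by rewrite invr_eq0.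
rewrite !qintE // !vi_inv !viN // !invrK -[vi i z - _]opprB -[vi i 1 - _]opprB.
by rewrite invrN mulrNN.
Qed.

Lemma Eword_inv i lam w : Eword A d N tt^-1 i lam w = Eword A d N tt i lam w.
Proof. by elim: w => //= j w ->; rewrite qint_inv. Qed.

Lemma in_serre_inv (f : (seq 'I_l -> K) -> K) : in_serre A d N tt^-1 f <-> in_serre A d N tt f.
Proof.
have qf i k : qfact d N tt^-1 i k = qfact d N tt i k.
  by rewrite /qfact; apply: eq_bigr => t _; rewrite qint_inv.
have E : serre_elt A d N tt^-1 = serre_elt A d N tt.
  apply: functional_extensionality => -[[[[a u] i] j] w].
  rewrite /serre_elt; congr (scale _ (map _ _)); rewrite /serre.
  by apply: eq_map => r; rewrite /qbin !qf.
by rewrite /in_serre E.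
Qed.

Lemma whittaker_inv k kap b th :
  whittaker A d N tt^-1 k kap b th <-> whittaker A d N tt k kap b th.
Proof.
have E i : Eword A d N tt^-1 i kap = Eword A d N tt i kap.
  by apply: functional_extensionality => w; rewrite Eword_inv.
split=> -[th0 thW thE]; split=> //.
- exact/in_serre_inv.
- by move=> i g gb; apply/in_serre_inv; have := thE i g gb; rewrite E.
- exact/in_serre_inv.
by move=> i g gb; apply/in_serre_inv; have := thE i g gb; rewrite -E.
Qed.

Definition whitCb (c : 'I_l -> K) lam i : K :=
  (c i)^-1 / (1 - vi i (- 2)) * vq N tt (formPP A d (nu i) lam) * v ^ (- nud i i).

Lemma whitC_inv c lam i : whitC tt^-1 (fun i => (c i)^-1) lam i = whitCb c lam i.
Proof. by rewrite /whitC /whitCb vi_inv vq_inv vX_inv invrK. Qed.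

Lemma WhitTr_invP c lam b th :
  WhitTr A d N tt^-1 (fun i => (c i)^-1) nu lam b th <->
  whittaker A d N tt (eigenN N tt nud (whitCb c lam)) lam b th.
Proof.
have i0 : tt^-1 != 0 by rewrite invr_eq0.
have -> : eigenN N tt nud (whitCb c lam) = eigen N tt^-1 nud (whitC tt^-1 (fun i => (c i)^-1) lam).
  apply: functional_extensionality => i; apply: functional_extensionality => g.
  by rewrite /eigenN /eigen whitC_inv vX_inv.
rewrite -whittaker_inv; apply: WhitTrP => //.
exact: invtt_order.
Qed.

Lemma vi2N_neq1 i : 1 - vi i (- 2) != 0.
Proof.
have := one_sub_vi2_neq0 tt_order N_gt0 (d_gt0 i); rewrite !subr_eq0.
by apply: contraNN => /eqP e; rewrite -[2]opprK viN // -e invr1.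
Qed.

(** The product of the two constants thus depends on i alone. It provides [CCb] for the recursion
    and, by comparing two highest weights, [CC'] for the orthogonality. *)
Lemma whitCCb c lam i : c i != 0 ->
  whitC tt c lam i * whitCb c lam i * ((1 - vi i 2) * (1 - vi i (- 2))) = 1.
Proof.
move=> c0; rewrite /whitC /whitCb.
have -> : v ^ (- nud i i) = (v ^ nud i i)^-1 by rewrite -invr_expz.
have := vi2N_neq1 i; have := vq_neq0 tt_neq0 (formPP A d (nu i) lam).
have := vX_neq0 N tt_neq0 (nud i i).
have := one_sub_vi2_neq0 tt_order N_gt0 (d_gt0 i).
move: (v ^ _) (vq _ _ _) (vi _ _) (vi _ _) => x y z w z0 x0 y0 w0.
by field; rewrite c0 x0 y0 z0 w0.
Qed.

Lemma whitC_neq0 c lam i : c i != 0 -> whitC tt c lam i != 0.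
Proof.
move=> c0; apply: contra_eq_neq (whitCCb lam c0) => ->.
by rewrite !mul0r eq_sym oner_eq0.
Qed.

Lemma whitCb_neq0 c lam i : c i != 0 -> whitCb c lam i != 0.
Proof.
move=> c0; apply: contra_eq_neq (whitCCb lam c0) => ->.
by rewrite mulr0 !mul0r eq_sym oner_eq0.
Qed.

Lemma WhitOK_unique c lam b : WhitOK A d N tt c nu lam b ->
  whit_unique A d N tt (eigen N tt nud (whitC tt c lam)) lam b.
Proof.
move=> [_ uniq] th th' /(WhitTrP tt_neq0 tt_order) thP /(WhitTrP tt_neq0 tt_order) th'P g gb.
by apply/veqP; apply: (uniq th th').
Qed.

Lemma pairing_shapovalov lam x y : pairing A d N tt lam x y = shapovalov A d N tt lam x y.
Proof.
rewrite /pairing /shapovalov /ev; apply: eq_bigr => p _; congr (_ * _).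
elim: p.2 y => [|j w IH] y /=; first by rewrite coef_ev.
rewrite IH -[LHS]/(ev (shap_word A d N tt lam w) _) ev_Elc; apply: eq_bigr => u _.
by rewrite Eword_inv.
Qed.

(** [epsilon] picks Whittaker vectors t and tb truncated at g. By [whittaker_pairing] the character
    of t g equals that of tb g, which in turn equals that of th g. *)
Lemma JvalE c lam b g th thb :
    whittaker A d N tt (eigen N tt nud (whitC tt c lam)) lam b th ->
    whittaker A d N tt (eigenN N tt nud (whitCb c lam)) lam b thb -> leQ g b ->
  Jval A d N tt c nu lam g =
    v ^ (- half_norm A d g + formPQ d lam g) * ev (chi (eigenN N tt nud (whitCb c lam))) (th g).
Proof.
move=> thP thbP gb; rewrite /Jval.
set t := epsilon _ _; set tb := epsilon _ _.
have gg : leQ g g by [].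
have tP : whittaker A d N tt (eigen N tt nud (whitC tt c lam)) lam g t.
  apply/(WhitTrP tt_neq0 tt_order); apply: epsilon_spec; exists th.
  by apply/(WhitTrP tt_neq0 tt_order); apply: whittaker_le thP.
have tbP : whittaker A d N tt (eigenN N tt nud (whitCb c lam)) lam g tb.
  apply/WhitTr_invP; apply: epsilon_spec; exists thb.
  by apply/WhitTr_invP; apply: whittaker_le thbP.
have [_ tW _] := tP; have thgP := whittaker_le gb thP.
have shap_word := whittaker_pairing tt_neq0 tt_order N_gt0 d_gt0 A_diag A_le0 A_sym.
rewrite pairing_shapovalov (shapovalov_whittaker tt_neq0 tt_order N_gt0 d_gt0 A_diag A_le0 A_sym tbP gg (tW g gg)).
rewrite (shap_word _ _ _ _ _ _ _ tP tbP gg) -(shap_word _ _ _ _ _ _ _ thgP tbP gg); congr (_ * _).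
have -> : - (formQQ A d g g)%:~R / 2 + (formPQ d lam g)%:~R =
          (- half_norm A d g + formPQ d lam g)%:~R :> rat.
  by rewrite (formQQ_even A_diag A_sym) rmorphD rmorphN rmorphM /=; field.
by rewrite vq_int.
Qed.

Lemma JvalE' c lam b g th thb :
    whittaker A d N tt (eigen N tt nud (whitC tt c lam)) lam b th ->
    whittaker A d N tt (eigenN N tt nud (whitCb c lam)) lam b thb -> leQ g b ->
  Jval A d N tt c nu lam g =
    v ^ (- half_norm A d g + formPQ d lam g) * ev (chi (eigen N tt nud (whitC tt c lam))) (thb g).
Proof.
move=> thP thbP gb; rewrite (JvalE thP thbP gb).
by rewrite (whittaker_pairing tt_neq0 tt_order N_gt0 d_gt0 A_diag A_le0 A_sym thP thbP gb).
Qed.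

End Inverse.
End Translation.

(** * The two identities *)

Section Main.
Variables (l : nat) (A : 'M[int]_l) (d : 'I_l -> nat) (K : fieldType) (N : nat).
Hypothesis N_gt0 : (0 < N)%N.
Hypothesis d_gt0 : forall i, (0 < d i)%N.
Hypothesis A_diag : forall i, A i i = 2.
Hypothesis A_le0 : forall i j, i != j -> A i j <= 0.
Hypothesis A_sym : forall i j, (d i)%:Z * A i j = (d j)%:Z * A j i.
Hypothesis A_posdef : forall x : 'I_l -> rat, (exists i, x i != 0) ->
  0 < \sum_i \sum_j x i * x j * (d i)%:R * (A i j)%:~R.
Hypothesis N_int : forall i j, denq (N%:R * formPP A d (fundw i) (fundw j)) = 1.
Variables (eps nu : 'I_l -> 'I_l -> int).
Hypothesis eps_skew : forall i j, eps i j = - eps j i.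
Hypothesis eps_adj : forall i j, i != j -> A i j != 0 -> (eps i j == 1) || (eps i j == -1).
Hypothesis eps_nadj : forall i j, (i == j) || (A i j == 0) -> eps i j = 0.
Hypothesis nu_eps : nu_ok A d eps nu.

(* A cyclically oriented set of nodes would have nonpositive norm. *)
Lemma source_exists (s : {set 'I_l}) : s != set0 ->
  exists2 i, i \in s & forall j, j \in s -> A i j != 0 -> j != i -> eps i j = -1.
Proof.
move=> /set0Pn[i0 i0s].
pose P i := (i \in s) && [forall j, (j \in s) && (A i j != 0) && (j != i) ==> (eps i j == -1)].
have [/existsP[i /andP[i_s /forallP Hi]]|/existsPn noP] := boolP [exists i, P i].
  exists i => // j js Aij ji; apply/eqP; have := Hi j.
  by rewrite js Aij ji.
exfalso.
(* The off-diagonal part of the form, distributed over the oriented edges from i to j. *)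
pose w i j : int := (eps i j == 1)%:R * ((d i)%:Z * A i j).
have wE i j : (d i)%:Z * A i j = (i == j)%:R * (2 * (d i)%:Z) + w i j + w j i.
  rewrite /w; have [<-|ij] := eqVneq i j.
    by rewrite eps_nadj ?eqxx // A_diag !mul0r mul1r !addr0 mulrC.
  have [A0|A0] := eqVneq (A i j) 0.
    have -> : A j i = 0.
      have := A_sym i j; rewrite A0 mulr0 => /esym/eqP.
      by rewrite mulf_eq0 => /orP[|/eqP //]; have := d_gt0 j; case: (d j).
    by rewrite A0 !mulr0 mul0r !addr0.
  rewrite mul0r add0r -(A_sym i j) [eps j i]eps_skew eqr_oppLR.
  by case/orP: (eps_adj ij A0) => /eqP ->; rewrite /= ?mul1r ?mul0r ?addr0 ?add0r.
have w_le i j : w i j <= 0.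
  rewrite /w; have [->|ij] := eqVneq i j; first by rewrite eps_nadj ?eqxx // mul0r.
  by case: (eps i j == 1); rewrite ?mul0r // mul1r mulr_ge0_le0 // A_le0.
(* Without a source of the required kind, every i in s has an edge to some j in s with eps_ij = 1,
   and a_ij is at most -1. Doubled, this outweighs (alpha_i, alpha_i) = 2 d_i, so the indicator
   vector of s has nonpositive norm. *)
have w_row i : i \in s -> \sum_(j in s) w i j <= - (d i)%:Z.
  move=> i_s; have := noP i; rewrite /P i_s /= => /forallPn[j].
  rewrite negb_imply => /andP[/andP[/andP[js Aij] ji] eij].
  have ij : i != j by rewrite eq_sym.
  have e1 : eps i j == 1 by case/orP: (eps_adj ij Aij) => // e; rewrite e in eij.
  rewrite (bigD1 j) //= -[leRHS]addr0 lerD //; last by apply: sumr_le0 => k _.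
  rewrite /w e1 mul1r; have := A_le0 ij; have := d_gt0 i.
  by move: Aij; move: (A i j) => x; nia.
have := @A_posdef (fun i => (i \in s)%:R) _; rewrite ltNge => H.
have {}H : ~~ (\sum_(i in s) \sum_(j in s) (d i)%:Z * A i j <= 0).
  have {}H := H (ex_intro _ i0 _); rewrite i0s oner_neq0 in H.
  have {H} := H isT; apply: contraNN => H.
  suff -> : \sum_i \sum_j (i \in s)%:R * (j \in s)%:R * (d i)%:R * (A i j)%:~R =
     (\sum_(i in s) \sum_(j in s) (d i)%:Z * A i j)%:~R :> rat by rewrite lerz0.
  rewrite rmorph_sum [RHS]big_mkcond; apply: eq_bigr => i _ /=.
  case: ifP => i_s; last by rewrite big1 // => j _; rewrite !mul0r.
  rewrite rmorph_sum [RHS]big_mkcond; apply: eq_bigr => j _ /=.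
  by case: ifP => js; rewrite ?mulr0 ?mul0r // !mul1r rmorphM /= -pmulrn.
move/negP: H; apply.
have -> : \sum_(i in s) \sum_(j in s) (d i)%:Z * A i j =
   \sum_(i in s) (2 * (d i)%:Z + 2 * \sum_(j in s) w i j).
  under eq_bigr do under eq_bigr do rewrite wE.
  under eq_bigr do rewrite !big_split /=.
  rewrite !big_split /= [X in _ + _ + X]exchange_big /= -addrA; congr (_ + _).
    apply: eq_bigr => i i_s; rewrite (bigD1 i) //= eqxx mul1r big1 ?addr0 // => j /andP[_].
    by rewrite eq_sym => /negbTE ->; rewrite mul0r.
  by rewrite -mulr_sumr mulr2n mulrDl mul1r.
apply: sumr_le0 => i /w_row H; have {}H : 2 * \sum_(j in s) w i j <= 2 * - (d i)%:Z by rewrite ler_pM2l.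
by rewrite -[leRHS](addrN (2 * (d i)%:Z)) lerD2l -mulrN.
Qed.

(** The node given by [source_exists] is put first and the construction repeated on the rest. Then
    eps_ij = -1 for adjacent i before j, and [nu_eps] translates this into the condition
    [es_order]. *)
Lemma ordering_exists : exists es : seq 'I_l,
  [/\ uniq es, forall i, i \in es &
      forall s1 i s2 j, es = s1 ++ i :: s2 -> j \in s2 ->
        nud d nu i j - nud d nu j i = - ((d i)%:Z * A i j)].
Proof.
pose r i j := (A i j != 0) ==> (eps i j == -1).
have H m (s : {set 'I_l}) : #|s| = m -> exists es, [/\ uniq es, es =i s & pairwise r es].
  elim: m s => [|m IH] s sm.
    by exists [::]; split=> // i; rewrite (cards0_eq sm) inE.
  have [|i i_s Hi] := @source_exists s; first by rewrite -card_gt0 sm.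
  have [|es [es_uniq esE es_r]] := IH (s :\ i).
    by have := cardsD1 i s; rewrite i_s sm => -[].
  have i_es : i \notin es by rewrite esE !inE eqxx.
  exists (i :: es); rewrite /= i_es es_uniq es_r andbT; split=> //.
    move=> j; rewrite inE esE !inE; case: eqP => [->|] //=.
  rewrite andbT; apply/allP => j; rewrite esE !inE => /andP[ji js]; apply/implyP => Aij.
  by rewrite Hi.
have [es [es_uniq esE es_r]] := H _ [set: 'I_l] erefl.
exists es; split=> // [i|s1 i s2 j e js]; first by rewrite esE inE.
have rij : r i j.
  move: es_r; rewrite e pairwise_cat /= => /and3P[_ _ /andP[/allP Hi _]].
  exact: Hi.
rewrite [LHS]nu_eps; move: rij; rewrite /r.
have [->|Aij] := eqVneq (A i j) 0; first by rewrite !mulr0 oppr0.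
by move=> /= /eqP ->; rewrite mulN1r.
Qed.

Variable tt : K.
Hypothesis tt_neq0 : tt != 0.
Hypothesis tt_order : forall n, (0 < n)%N -> tt ^+ n != 1.
Variables (c : 'I_l -> K) (lam : 'I_l -> int) (b : 'I_l -> nat) (S : nat).
Hypothesis c_neq0 : forall i, c i != 0.
Hypothesis bS : forall j, (b j <= S)%N.
Hypothesis WD : forall al : 'I_l -> nat, leQ al b ->
  Wdef A d N tt c nu (fun k => rootw A al k - lam k - 2) al /\
  Wdef A d N tt c nu (fun k => lam k - rootw A al k) (subQ b al).
Local Notation D := {ffun 'I_l -> 'I_S.+1}.
Local Notation v := (tt ^+ N).
Local Notation J := (Jval A d N tt c nu).
Local Notation whit k kap b th := (whittaker A d N tt k kap b th).
Local Notation kC kap := (eigen N tt (nud d nu) (whitC A d N nu tt c kap)).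
Local Notation kCb kap := (eigenN N tt (nud d nu) (whitCb A d N nu tt c kap)).
Implicit Types (kap : 'I_l -> int).

Definition lam_minus (a : 'I_l -> nat) : 'I_l -> int := fun k => lam k - rootw A a k.
Definition lam_dual (a : 'I_l -> nat) : 'I_l -> int := fun k => rootw A a k - lam k - 2.
(** Since q = v^2, the inverse of this is the factor q^(-(a,a)/2 + (lam + rho, a)) of the first
    identity. *)
Definition casimir (a : 'I_l -> nat) : K := v ^ casimir_log A d lam a.

Lemma casimir_neq0 a : casimir a != 0. Proof. exact: vX_neq0. Qed.

Lemma Wdef_whittaker kap g : Wdef A d N tt c nu kap g ->
  (exists th, whit (kC kap) kap g th) /\ (exists thb, whit (kCb kap) kap g thb).
Proof.
move=> [[[th thP] _] [[thb thbP] _]]; split.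
  by exists th; apply/(WhitTrP N_gt0 d_gt0 A_posdef N_int nu tt_neq0 tt_order).
by exists thb; apply/(WhitTr_invP N_gt0 d_gt0 A_posdef N_int nu tt_neq0 tt_order).
Qed.

Lemma whitC_shift kap g i :
  whitC A d N nu tt c (fun k => kap k - rootw A g k) i =
  whitC A d N nu tt c kap i * v ^ nform (nud d nu) i g.
Proof.
rewrite /whitC (@formPP_rootw _ _ _ d_gt0 A_posdef nu _ _ _ i) //.
rewrite vq_subint //; last exact: formPP_int.
by rewrite -invr_expz invfM invrK; ring.
Qed.

Lemma casimir_log_addQ a g : casimir_log A d lam (addQ a g) =
  casimir_log A d lam a + casimir_log A d lam g + 2 * formQQ A d a g.
Proof.
rewrite /casimir_log formPQ_addQ formQQ_addQl !(formQQ_addQr A_sym) (formQQ_sym A_sym g a).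
by ring.
Qed.

Lemma casimir_log_lam_minus a g :
  casimir_log A d (lam_minus a) g = casimir_log A d lam g + 2 * formQQ A d a g.
Proof.
rewrite /casimir_log /lam_minus; have -> : (fun i => lam i - rootw A a i + 1) = (fun i => (lam i + 1) - rootw A a i).
  by apply: functional_extensionality => i; ring.
by rewrite (formPQ_sub d (fun i => lam i + 1)) (formPQ_rootw A_sym); ring.
Qed.

(** The right side depends on g and h only through g + h, so the power of v leaves the sum in
    [J_orthogonality]. *)
Lemma orth_exponent a g h (a' := addQ g (addQ a h)) :
  (- half_norm A d g + formPQ d (lam_dual a') g) + (- half_norm A d h + formPQ d (lam_minus a) h) +
    casimir_log A d lam (addQ a h) - casimir_log A d lam a' =
  formPQ d lam (addQ g h) - half_norm A d (addQ g h) - formQQ A d a (addQ g h).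
Proof.
rewrite /a' /lam_dual /lam_minus.
rewrite (formPQ_sub d (fun k => rootw A _ k - lam k) (fun=> 2)).
rewrite (formPQ_sub d (rootw A _) lam) (formPQ_rootw A_sym) (formPQ_sub d lam) (formPQ_rootw A_sym).
rewrite [casimir_log A d lam (addQ g _)]casimir_log_addQ.
have -> : casimir_log A d lam g = formQQ A d g g - 2 * (formPQ d lam g + formPQ d (fun=> 1) g).
  by rewrite /casimir_log (formPQ_add d lam (fun=> 1)).
have -> : formPQ d (fun=> 2) g = 2 * formPQ d (fun=> 1) g.
  by rewrite /formPQ mulr_sumr; apply: eq_bigr => j _; ring.
rewrite formPQ_addQ (half_norm_addQ A_diag A_sym) !formQQ_addQl !(formQQ_addQr A_sym).
rewrite (formQQ_even A_diag A_sym g) (formQQ_sym A_sym g a) (formQQ_sym A_sym g h).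
by ring.
Qed.

(** [whittaker_orthogonality] at highest weight lam - a and with B = a' - a: the partner weight B -
    (lam - a) - 2 rho is [lam_dual a']. For a' = a only the product of two values J_0 = 1 is
    left. *)
Lemma J_orthogonality a a' : leQ a a' -> leQ a' b ->
  \sum_(g : D | lebQ (deg g) (subQ a' a))
     J (lam_dual a') (deg g) * J (lam_minus a) (subQ (subQ a' a) (deg g)) *
     (casimir (subQ a' (deg g)) / casimir a') = (lebQ a' a)%:R.
Proof.
move=> aa' a'b; have ab := leQ_trans aa' a'b.
pose B := subQ a' a.
have BbA : leQ B (subQ b a) by move=> j; apply: leq_sub2r.
have Ba' : leQ B a' by apply: leQ_subl.
have [[th thP] [thb thbP]] := Wdef_whittaker (WD ab).2.
have [[th' th'P] [thb' thb'P]] := Wdef_whittaker (WD a'b).1.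
have [[th2 th2P] _] := Wdef_whittaker (WD a'b).2.
have JE g : leQ g (subQ b a) -> J (lam_minus a) g =
    v ^ (- half_norm A d g + formPQ d (lam_minus a) g) * ev (chi (kCb (lam_minus a))) (th g).
  exact: (JvalE N_gt0 d_gt0 A_diag A_le0 A_sym A_posdef N_int tt_neq0 tt_order thP thbP).
have JE' g : leQ g a' -> J (lam_dual a') g =
    v ^ (- half_norm A d g + formPQ d (lam_dual a') g) * ev (chi (kC (lam_dual a'))) (thb' g).
  exact: (JvalE' N_gt0 d_gt0 A_diag A_le0 A_sym A_posdef N_int tt_neq0 tt_order th'P thb'P).
transitivity (v ^ (formPQ d lam B - half_norm A d B - formQQ A d a B) *
  \sum_(g : D | lebQ (deg g) B) ev (chi (kC (lam_dual a'))) (thb' (deg g)) *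
    ev (chi (kCb (lam_minus a))) (th (subQ B (deg g)))).
  rewrite mulr_sumr; apply: eq_bigr => g /lebQP gB.
  rewrite JE'; last exact: leQ_trans gB Ba'.
  rewrite JE; last by apply: leQ_trans BbA; apply: leQ_subl.
  have e1 : subQ a' (deg g) = addQ a (subQ B (deg g)).
    apply: functional_extensionality => j; have := aa' j; have := gB j.
    by rewrite /B /subQ /addQ; clear; move: (deg g j) (a j) (a' j) => x y z; lia.
  have e2 : a' = addQ (deg g) (addQ a (subQ B (deg g))).
    apply: functional_extensionality => j; have := aa' j; have := gB j.
    by rewrite /B /subQ /addQ; clear; move: (deg g j) (a j) (a' j) => x y z; lia.
  have := orth_exponent a (deg g) (subQ B (deg g)); rewrite -e2 -e1 addQ_subQ // => <-.
  rewrite /casimir; move: (casimir_log A d lam (subQ a' (deg g))) (casimir_log A d lam a') => f1 f2.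
  rewrite -/B; move: (- half_norm A d _ + _) (- half_norm A d _ + _) (ev _ _) (ev _ _) => E1 E2 x y.
  by rewrite (vXD _ tt_neq0 _ (- f2)) !(vXD _ tt_neq0) -[v ^ (- f2)]invr_expz; ring.
case: (boolP (lebQ a' a)) => a'a.
  have e : a' = a.
    apply: functional_extensionality => j; apply/eqP; rewrite eqn_leq aa'.
    by move/lebQP: a'a => ->.
  have B0 : B = @zeroQ l by rewrite /B e subQQ.
  rewrite B0 (sum_zeroQ S (fun g => ev (chi (kC (lam_dual a'))) (thb' g) *
    ev (chi (kCb (lam_minus a))) (th (subQ (@zeroQ l) g)))) subQQ.
  rewrite (ev_chi_whittaker0 tt_neq0 tt_order N_gt0 d_gt0 A_diag A_le0 A_sym thP thbP).
  rewrite (ev_chi_whittaker0 tt_neq0 tt_order N_gt0 d_gt0 A_diag A_le0 A_sym thb'P th'P).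
  have -> : formPQ d lam (@zeroQ l) = 0 by rewrite /formPQ big1 // => j _; rewrite mulr0 mul0r.
  have -> : formQQ A d a (@zeroQ l) = 0.
    by rewrite /formQQ big1 // => i _; rewrite big1 // => j _; rewrite mulr0 mul0r.
  by rewrite half_norm0 !subr0 expr0z !mulr1.
have B0 : exists i, B i != 0%N.
  case/forallPn: a'a => j; rewrite -ltnNge => aj; exists j.
  by rewrite /B /subQ -lt0n subn_gt0.
have uniq := WhitOK_unique N_gt0 d_gt0 A_posdef N_int tt_neq0 tt_order (WD ab).2.1.
have C0 kap i := whitC_neq0 A N_gt0 d_gt0 nu tt_neq0 tt_order kap (c_neq0 i).
have Cb0 kap i := whitCb_neq0 A N_gt0 d_gt0 nu tt_neq0 tt_order kap (c_neq0 i).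
have CC kap i := whitCCb A N_gt0 d_gt0 nu tt_neq0 tt_order kap (c_neq0 i).
have CC' i : whitC A d N nu tt c (lam_minus a) i * whitCb A d N nu tt c (lam_minus a) i =
    whitC A d N nu tt c (lam_dual a') i * whitCb A d N nu tt c (lam_dual a') i.
  have nz : (1 - vpow d N tt i 2) * (1 - vpow d N tt i (- 2)) != 0.
    by apply: contra_eq_neq (CC (lam_minus a) i) => ->; rewrite mulr0 eq_sym oner_eq0.
  by apply: (mulIf nz); rewrite !CC.
have BS j : (B j <= S)%N by apply: leq_trans (bS j); apply: leq_trans (a'b j); apply: Ba'.
have kapE i : lam_dual a' i = rootw A B i - lam_minus a i - 2.
  by rewrite /lam_dual /lam_minus /B (rootw_subQ A i aa'); ring.
rewrite (whittaker_orthogonality tt_neq0 tt_order N_gt0 d_gt0 A_diag A_le0 A_sym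
  (Cb0 (lam_minus a)) (C0 (lam_dual a')) CC' BS BbA B0 kapE thP thbP (whittaker_le Ba' thb'P) uniq).
  by rewrite mulr0.
exists th2; have e : (fun i => lam_minus a i - rootw A B i) = lam_minus a'.
  by apply: functional_extensionality => i; rewrite /lam_minus /B (rootw_subQ A i aa'); ring.
have -> : subQ (subQ b a) B = subQ b a'.
  apply: functional_extensionality => j; have := aa' j; have := a'b j.
  by rewrite /B /subQ; clear; move: (b j) (a j) (a' j) => x y z; lia.
(* By [whitC_shift], shifting the degree by B amounts to lowering the highest weight by B, so the
   Whittaker vector at lam - a' has the eigenvalues required of [th2]. *)
rewrite e; suff -> : (fun i g => kC (lam_minus a) i (addQ g B)) = kC (lam_minus a') by [].
apply: functional_extensionality => i; apply: functional_extensionality => g.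
by rewrite /eigen -e whitC_shift nf_addQ vXD //; ring.
Qed.

Lemma J_recursion a a' : leQ a a' -> leQ a' b ->
  casimir a * J (lam_minus a) (subQ a' a) =
  \sum_(g : D | lebQ (deg g) (subQ a' a))
     casimir (addQ a (deg g)) / qpoch d N tt (subQ (subQ a' a) (deg g)) * J (lam_minus a) (deg g).
Proof.
move=> aa' a'b; have ab := leQ_trans aa' a'b.
pose B := subQ a' a.
have BbA : leQ B (subQ b a) by move=> j; apply: leq_sub2r.
have [[th thP] [thb thbP]] := Wdef_whittaker (WD ab).2.
have JE g : leQ g (subQ b a) -> J (lam_minus a) g =
    v ^ (- half_norm A d g + formPQ d (lam_minus a) g) * ev (chi (kCb (lam_minus a))) (th g).
  exact: (JvalE N_gt0 d_gt0 A_diag A_le0 A_sym A_posdef N_int tt_neq0 tt_order thP thbP).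
have uniq := WhitOK_unique N_gt0 d_gt0 A_posdef N_int tt_neq0 tt_order (WD ab).2.1.
have C0 i := whitC_neq0 A N_gt0 d_gt0 nu tt_neq0 tt_order (lam_minus a) (c_neq0 i).
have Cb0 i := whitCb_neq0 A N_gt0 d_gt0 nu tt_neq0 tt_order (lam_minus a) (c_neq0 i).
have CC i := whitCCb A N_gt0 d_gt0 nu tt_neq0 tt_order (lam_minus a) (c_neq0 i).
have [es [es_uniq es_all es_order]] := ordering_exists.
have bS' j : (subQ b a j <= S)%N by apply: leq_trans (bS j); rewrite leq_subr.
rewrite JE // (whittaker_recursion tt_neq0 tt_order N_gt0 d_gt0 A_diag A_le0 A_sym es_uniq es_all es_order Cb0 CC bS' thP thbP uniq BbA).
rewrite !mulr_sumr; apply: eq_bigr => g /lebQP gB.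
rewrite JE; last exact: leQ_trans gB BbA.
(* The normalizing powers of J at B and at g turn [casimir_exp] into a difference of Casimir
   exponents at a + g and at a. *)
have E : casimir_log A d lam a + (- half_norm A d B + formPQ d (lam_minus a) B) +
    casimir_exp A d (lam_minus a) (subQ B (deg g)) (deg g) =
    casimir_log A d lam (addQ a (deg g)) + (- half_norm A d (deg g) + formPQ d (lam_minus a) (deg g)).
  rewrite /casimir_exp casimir_log_lam_minus casimir_log_addQ -{1 2}(addQ_subQ gB) (half_norm_addQ A_diag A_sym) formPQ_addQ.
  by ring.
rewrite /casimir -/B; move: (qpoch _ _ _ _)^-1 (ev _ _) E => p x.
move: (casimir_exp _ _ _ _ _) (- half_norm A d (deg g) + _) (- half_norm A d B + _) => E3 E2 E1.
move: (casimir_log A d lam (addQ a (deg g))) (casimir_log A d lam a) => f2 f1 E.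
transitivity (v ^ (f1 + E1 + E3) * p * x); first by rewrite !vXD //; ring.
by rewrite E vXD //; ring.
Qed.

Lemma sum_rev (F : ('I_l -> nat) -> K) a a' : leQ a a' -> (forall j, (a' j <= S)%N) ->
  \sum_(g : D | lebQ (deg g) (subQ a' a)) F (deg g) =
  \sum_(z : D | lebQ a (deg z) && lebQ (deg z) a') F (subQ a' (deg z)).
Proof.
move=> aa' a'S; pose h (z : D) : D := [ffun j => inord (a' j - z j)].
have hE z j : h z j = (a' j - z j)%N :> nat.
  by rewrite ffunE inordK // ltnS (leq_trans (leq_subr _ _)).
have hE' z : deg (h z) = subQ a' (deg z).
  by apply: functional_extensionality => j; rewrite /deg hE.
rewrite (reindex_onto h h) => [|g /lebQP ga]; last first.
  apply/ffunP => j; apply/val_inj; rewrite /= !hE.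
  by have := ga j; have := aa' j; rewrite /subQ /deg; clear; lia.
apply: eq_big => [z|z _]; last by rewrite hE'.
(* As the subtraction is truncated, h (h z) = z expresses that z is below a'. *)
rewrite hE'; apply/andP/andP => -[H1 H2].
  have za j : (z j <= a' j)%N.
    by move/eqP: H2 => H2; have := congr1 (fun y : D => nat_of_ord (y j)) H2; rewrite /= !hE; lia.
  split; apply/lebQP => j; last exact: za.
  have := elimT (lebQP _ _) H1 j; have := za j; have := aa' j; rewrite /subQ /deg; clear; lia.
split; first apply/lebQP => j.
  by have := elimT (lebQP _ _) H1 j; have := elimT (lebQP _ _) H2 j; rewrite /subQ /deg; clear; lia.
apply/eqP/ffunP => j; apply/val_inj; rewrite /= !hE.
by have := elimT (lebQP _ _) H2 j; rewrite /deg; clear; lia.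
Qed.

Lemma sum_translate (F : ('I_l -> nat) -> K) a a' : leQ a a' -> (forall j, (a' j <= S)%N) ->
  \sum_(g : D | lebQ (deg g) (subQ a' a)) F (deg g) =
  \sum_(z : D | lebQ a (deg z) && lebQ (deg z) a') F (subQ (deg z) a).
Proof.
move=> aa' a'S; rewrite (sum_rev (fun g => F g)) //.
have ww (z : D) : lebQ a (deg z) && lebQ (deg z) a' ->
    forall j, (a j <= z j <= a' j)%N.
  by case/andP=> /lebQP z1 /lebQP z2 j; rewrite z1 z2.
(* Reflection of the interval from a to a'; composed with the reflection of [sum_rev] it is the
   translation by a. *)
pose h (z : D) : D := [ffun j => inord (a j + a' j - z j)].
have hE (z : D) j : (a j <= z j <= a' j)%N -> h z j = (a j + a' j - z j)%N :> nat.
  move=> H; rewrite ffunE inordK //; have := a'S j; have := aa' j; move: H; clear; lia.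
have hw (z : D) : lebQ a (deg z) && lebQ (deg z) a' -> lebQ a (deg (h z)) && lebQ (deg (h z)) a'.
  move=> /ww H; apply/andP; split; apply/lebQP => j; rewrite /deg hE //; have := H j; clear; lia.
rewrite (reindex_onto h h) => [|z /[dup] /hw /ww H1 /ww H]; last first.
  by apply/ffunP => j; apply/val_inj; rewrite /= !hE //; have := H j; clear; lia.
apply: eq_big => [z|z /andP[/hw hz /eqP e]].
  apply/andP/idP => [[/hw H /eqP <-] //|H]; split; first exact: hw.
  have H1 := ww _ (hw _ H); have H0 := ww _ H.
  by apply/eqP/ffunP => j; apply/val_inj; rewrite /= !hE //; have := H0 j; clear; lia.
rewrite e in hz; congr F; apply: functional_extensionality => j; rewrite /subQ /deg.
by have H := ww _ hz j; rewrite hE //; move: H; clear; lia.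
Qed.

(** [F] and [G] are the two triangular matrices on the interval from 0 to b, and [FG] is the
    orthogonality. The first identity is the entry (b, 0) of the product in the other order. *)
Lemma J_identities :
  (\sum_(a : D | lebQ (deg a) b) J (lam_dual (deg a)) (deg a) * J (lam_minus (deg a)) (subQ b (deg a)) / casimir (deg a)
     = (lebQ b (@zeroQ l))%:R) /\
  (\sum_(a : D | lebQ (deg a) b) J (lam_dual (deg a)) (deg a) * J (lam_minus (deg a)) (subQ b (deg a))
     = (qpoch d N tt b)^-1).
Proof.
pose bD : D := [ffun j => inord (b j)].
pose zD : D := [ffun=> ord0].
have bE : deg bD = b.
  by apply: functional_extensionality => j; rewrite /deg ffunE inordK // ltnS.
have zE : deg zD = @zeroQ l by apply: functional_extensionality => j; rewrite /deg ffunE.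
pose P (z : D) := lebQ (deg z) b.
have PbD : P bD by rewrite /P bE; apply/lebQP.
have PzD : P zD by rewrite /P zE; apply/lebQP.
pose F (x z : D) := if lebQ (deg z) (deg x) then
  J (lam_dual (deg x)) (subQ (deg x) (deg z)) * (casimir (deg z) / casimir (deg x)) else 0.
pose G (z y : D) := if lebQ (deg y) (deg z) then J (lam_minus (deg y)) (subQ (deg z) (deg y)) else 0.
have DS (x : D) j : (deg x j <= S)%N by rewrite -ltnS ltn_ord.
have FG x y : P x -> P y -> \sum_(z | P z) F x z * G z y = (x == y)%:R.
  move=> /lebQP xb /lebQP yb.
  have [/lebQP yx|yx] := boolP (lebQ (deg y) (deg x)); last first.
    rewrite big1 => [|z _].
      by case: eqP yx => // ->; rewrite (introT (lebQP _ _)).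
    rewrite /F /G; case: (boolP (lebQ (deg z) (deg x))) => [/lebQP zx|]; last by rewrite mul0r.
    case: (boolP (lebQ (deg y) (deg z))) => [/lebQP yz|]; last by rewrite mulr0.
    by case/lebQP: yx; apply: leQ_trans yz zx.
  have -> : (x == y) = lebQ (deg x) (deg y).
    apply/eqP/lebQP => [-> //|xy]; apply/ffunP => j; apply/val_inj/eqP.
    by rewrite /= eqn_leq -[nat_of_ord (x j)]/(deg x j) -[nat_of_ord (y j)]/(deg y j) xy yx.
  rewrite -(J_orthogonality yx xb).
  rewrite (sum_rev (fun g => J (lam_dual (deg x)) g * J (lam_minus (deg y)) (subQ (subQ (deg x) (deg y)) g) *
     (casimir (subQ (deg x) g) / casimir (deg x)))) //.
  rewrite (bigID (fun z : D => lebQ (deg y) (deg z) && lebQ (deg z) (deg x))) /= [X in _ + X]big1 ?addr0.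
    apply: eq_big => [z|z /andP[_ /andP[yz zx]]].
      apply: andb_idl => /andP[_ /lebQP zx]; apply/lebQP; exact: leQ_trans zx xb.
    rewrite /F /G yz zx.
    have -> : subQ (subQ (deg x) (deg y)) (subQ (deg x) (deg z)) = subQ (deg z) (deg y).
      apply: functional_extensionality => j; have := elimT (lebQP _ _) yz j; have := elimT (lebQP _ _) zx j.
      by rewrite /subQ; clear; lia.
    have -> : subQ (deg x) (subQ (deg x) (deg z)) = deg z.
      apply: functional_extensionality => j; have := elimT (lebQP _ _) zx j.
      by rewrite /subQ; clear; lia.
    by ring.
  move=> z /andP[_]; rewrite negb_and /F /G => /orP[] /negbTE ->; rewrite ?mul0r ?mulr0 //.
have GF := sum_left_inverse FG.
have ew0 : casimir (@zeroQ l) = 1.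
  rewrite /casimir /casimir_log /formQQ big1 => [|i _]; last by rewrite big1 // => j _; rewrite mul0r.
  by rewrite /formPQ big1 ?mulr0 ?subr0 ?expr0z // => j _; rewrite mulr0 mul0r.
have Fz z : F z zD = J (lam_dual (deg z)) (deg z) / casimir (deg z).
  by rewrite /F zE (introT (lebQP _ _)) // subQ0 ew0 div1r.
have Gb z : P z -> G bD z = J (lam_minus (deg z)) (subQ b (deg z)) by rewrite /P /G bE => ->.
split.
  have -> : lebQ b (@zeroQ l) = (bD == zD).
    apply/idP/eqP => [b0|e]; last by rewrite -bE -zE e; apply/lebQP.
    apply/ffunP => j; apply/val_inj => /=; rewrite -[LHS]/(deg bD j) -[RHS]/(deg zD j).
    by rewrite bE zE (lebQ_zero b0).
  rewrite -(GF _ _ PbD PzD); apply: eq_bigr => z Pz.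
  by rewrite Gb // Fz mulrA [J (lam_minus _) _ * _]mulrC.
(* The recursion expands [casimir (deg z)] times J at b - z, and this factor cancels the denominator
   in [F z zD]. After exchanging the sums, the inner one is the entry (x, 0) of the inverse
   relation, so only x = 0 survives and contributes 1 / (q)_b. *)
transitivity (\sum_(z | P z) \sum_(x | P x) (casimir (deg x) / qpoch d N tt (subQ b (deg x))) * G x z * F z zD).
  apply: eq_bigr => z Pz; have zb := elimT (lebQP _ _) Pz.
  rewrite Fz -mulr_suml.
  have -> : \sum_(x | P x) casimir (deg x) / qpoch d N tt (subQ b (deg x)) * G x z =
            casimir (deg z) * J (lam_minus (deg z)) (subQ b (deg z)).
    have bb : leQ b b by [].
    rewrite (J_recursion zb bb).
    rewrite (sum_translate (fun g => casimir (addQ (deg z) g) / qpoch d N tt (subQ (subQ b (deg z)) g) * J (lam_minus (deg z)) g)) //.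
    rewrite (bigID (fun x : D => lebQ (deg z) (deg x))) /= [X in _ + X]big1 ?addr0.
      apply: eq_big => [x|x /andP[Px zx]]; first by rewrite andbC.
      rewrite /G zx addQ_subQ; last exact/lebQP.
      have -> // : subQ (subQ b (deg z)) (subQ (deg x) (deg z)) = subQ b (deg x).
      apply: functional_extensionality => j; have := elimT (lebQP _ _) zx j; have := elimT (lebQP _ _) Px j.
      by rewrite /subQ; clear; lia.
    by move=> x /andP[_ /negbTE zx]; rewrite /G zx mulr0.
  have := casimir_neq0 (deg z); move: (casimir _) (J _ _) (J _ _) => e j1 j2 e0.
  by field.
rewrite exchange_big /=.
under eq_bigr do (under eq_bigr do rewrite -mulrA; rewrite -mulr_sumr).
rewrite (bigD1 zD) //= GF // eqxx mulr1 zE subQ0 ew0 div1r big1 ?addr0 //.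
by move=> x /andP[Px /negbTE xz]; rewrite GF // xz mulr0.
Qed.

End Main.

Lemma tC_neq0 (R : realType) : tC R != 0.
Proof. by rewrite /tC -tofrac0 tofrac_eq polyX_eq0. Qed.

Lemma tC_order (R : realType) n : (0 < n)%N -> tC R ^+ n != 1.
Proof.
move=> n0; rewrite /tC -tofracXn -tofrac1 tofrac_eq.
by apply/eqP => /(congr1 (fun p : {poly _} => size p)); rewrite size_polyXn size_poly1; case: n n0.
Qed.

Theorem theorem4p12 (R : realType) (l : nat) (A : 'M[int]_l) (d : 'I_l -> nat)
  (N : nat) (eps nu : 'I_l -> 'I_l -> int) (c : 'I_l -> KC R)
  (lam : 'I_l -> int) (b : 'I_l -> nat) :
  cartan_simple A d ->
  N_ok A d N ->
  eps_ok A eps ->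
  nu_ok A d eps nu ->
  (forall i, c i != 0) ->
  (* all the J's occurring in the sums are well defined at lam *)
  (forall al : 'I_l -> nat, leQ al b ->
     Wdef A d N (tC R) c nu (fun k => rootw A al k - lam k - 2) al /\
     Wdef A d N (tC R) c nu (fun k => lam k - rootw A al k) (subQ b al)) ->
  let J := Jval A d N (tC R) c nu in
  let S := (\sum_i b i)%N in
  (\sum_(a : {ffun 'I_l -> 'I_S.+1} | [forall i, (a i <= b i)%N])
     (let al := fun i => (a i : nat) in
      J (fun k => rootw A al k - lam k - 2) al *
      J (fun k => lam k - rootw A al k) (subQ b al) *
      vq N (tC R) (2%:R * (- (formQQ A d al al)%:~R / 2%:R
                            + (formPQ d (fun k => lam k + 1) al)%:~R)))
   = if [forall i, b i == 0%N] then 1 else 0)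
  /\
  (typeADE A ->
   \sum_(a : {ffun 'I_l -> 'I_S.+1} | [forall i, (a i <= b i)%N])
      (let al := fun i => (a i : nat) in
       J (fun k => rootw A al k - lam k - 2) al *
       J (fun k => lam k - rootw A al k) (subQ b al))
   = (qpoch d N (tC R) b)^-1).
Proof.
move=> [_ [A_diag [A_le0 [d_gt0 [A_sym [_ [A_posdef _]]]]]]] [N_gt0 N_int].
move=> [eps_skew eps_adj eps_nadj] nu_eps c_neq0 WD J S.
have bS j : (b j <= S)%N by rewrite /S (bigD1 j) //= leq_addr.
have [H1 H2] := J_identities N_gt0 d_gt0 A_diag A_le0 A_sym A_posdef N_int
  eps_skew eps_adj eps_nadj nu_eps (tC_neq0 R) (@tC_order R) c_neq0 bS WD.
split=> [|_]; last exact: H2.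
have -> : (if [forall i, b i == 0%N] then 1 else 0 : KC R) = (lebQ b (@zeroQ l))%:R.
  have -> : [forall i, b i == 0%N] = lebQ b (@zeroQ l).
    by apply: eq_forallb => i; rewrite leqn0.
  by case: (lebQ _ _).
rewrite -H1; apply: eq_bigr => a _; congr (_ * _); rewrite /casimir invr_expz -vq_int; congr vq.
rewrite /casimir_log rmorphN rmorphB rmorphM /=.
move: (formQQ _ _ _ _) (formPQ _ _ _) => x y.
by field.
Qed.
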